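(* Let $H$ be a group with generating set $S$ (not necessarily finite), let $\Gamma=H\wr\mathbb{Z}$, and let $\Sigma=S\cup\{s\}$, where $s$ is the positive generator of $\mathbb{Z}$. Then the non-equivariant and equivariant Hilbert space compressions satisfy $$R(H,S)\ \geqslant\ R(\Gamma,\Sigma)\ \geqslant\ \frac{R(H,S)}{R(H,S)+1}\,,$$ $$R_H(H,S)\ \geqslant\ R_\Gamma(\Gamma,\Sigma)\ \geqslant\ \max\left\{R_H(H,S)-\frac12\,,\ \frac{R_H(H,S)}{2R_H(H,S)+1}\right\}.$$
   Context: Wreath product: $H\wr\mathbb{Z}=\left(\bigoplus_{\mathbb{Z}}H\right)\rtimes\mathbb{Z}$, where $\bigoplus_{\mathbb{Z}}H$ is the group of finitely supported functions $\lambda:\mathbb{Z}\to H$ and $\mathbb{Z}$ acts by $(n\cdot\lambda)(x)=\lambda(x-n)$. The group $H$ embeds in $H\wr\mathbb{Z}$ as the copy of index $0$, so that $\Sigma$ generates $H\wr\mathbb{Z}$. Let $(X,d)$ be a uniformly discrete metric space (there is $\delta>0$ with $d(x,y)\geqslant\delta$ whenever $x\ne y$). The Hilbert space compression $R(X,d)$ is the supremum of the numbers $\alpha\in[0,1]$ such that there exist a Hilbert space $\mathcal{H}$, positive constants $C_1,C_2$ and a map $f:X\to\mathcal{H}$ with $$C_1\, d(x,y)^\alpha\leqslant\|f(x)-f(y)\|\leqslant C_2\, d(x,y)\quad\text{for all }x,y\in X.$$ If a group $G$ acts on $(X,d)$ by isometries, the equivariant Hilbert space compression $R_G(X,d)$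 is the supremum of the numbers $\alpha\in[0,1]$ such that there exist a Hilbert space $\mathcal{H}$ endowed with an action of $G$ by affine isometries, positive constants $C_1,C_2$ and a $G$-equivariant map $f:X\to\mathcal{H}$ satisfying the same inequalities. For a group $G$ with a (not necessarily finite) generating set $T$, $R(G,T)$ and $R_G(G,T)$ denote these quantities for $X=G$ with the word metric $d(x,y)=|x^{-1}y|$ associated with $T$ and the action of $G$ by left multiplication. *)

(* Defs.v *)
From HB Require Import structures.
From mathcomp Require Import all_boot all_order all_algebra finmap.
From mathcomp Require Import all_classical all_reals all_analysis.

Set Implicit Arguments.
Unset Strict Implicit.
Unset Printing Implicit Defensive.

Import Order.TTheory GRing.Theory Num.Theory.
Import numFieldNormedType.Exports.

Local Open Scope classical_set_scope.
Local Open Scope ring_scope.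

Section WordMetric.
Context {G : groupType}.
Implicit Types (S : set G) (x y : G) (n : nat).

Definition is_word S n x : Prop :=
  exists w : seq G, [/\ size w = n,
    (forall a, a \in w -> S a \/ S a^-1%g) & x = (\prod_(a <- w) a)%g].

Definition generates S : Prop := forall x, exists n, is_word S n x.

(* The default value 0 is only used when [x] is not a product of elements of
   [S] and their inverses, which does not happen when [generates S]. *)
Definition word_length S x : nat :=
  xget 0%N [set n | is_word S n x /\ forall m, is_word S m x -> (n <= m)%N].

Definition word_dist (R : realType) S x y : R := (word_length S (x^-1 * y)%g)%:R.

Lemma is_word1 S : is_word S 0 1%g.
Proof. by exists [::]; split=> //; rewrite big_nil. Qed.

Lemma is_word_gen S x : S x -> is_word S 1 x.
Proof.
move=> Sx; exists [:: x]; split=> //; last by rewrite big_seq1.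
by move=> a; rewrite inE => /eqP ->; left.
Qed.

Lemma is_wordM S m n x y :
  is_word S m x -> is_word S n y -> is_word S (m + n) (x * y)%g.
Proof.
move=> [w [<- Sw ->]] [v [<- Sv ->]]; exists (w ++ v); split.
- by rewrite size_cat.
- by move=> a; rewrite mem_cat => /orP[/Sw|/Sv].
- by rewrite big_cat.
Qed.

Lemma is_wordV S n x : is_word S n x -> is_word S n x^-1%g.
Proof.
move=> [w [<- Sw ->]]; elim: w Sw => [_|a w IHw Sw].
  by rewrite big_nil invg1; apply: is_word1.
rewrite big_cons invgM /= -addn1; apply: is_wordM.
  by apply: IHw => b bw; apply: Sw; rewrite inE bw orbT.
exists [:: a^-1%g]; split=> //; last by rewrite big_seq1.
move=> b; rewrite inE => /eqP ->; rewrite invgK.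
by case: (Sw a (mem_head _ _)); [right|left].
Qed.

Lemma word_lengthP S x : generates S ->
  is_word S (word_length S x) x /\
  (forall m, is_word S m x -> (word_length S x <= m)%N).
Proof.
move=> genS.
have exS : exists n, `[<is_word S n x>].
  by case: (genS x) => n Sn; exists n; apply/asboolP.
suff /(xgetPex 0%N) : exists n, is_word S n x /\
    forall m, is_word S m x -> (n <= m)%N by [].
case: (ex_minnP exS) => n /asboolP Sn nmin.
by exists n; split=> // m Sm; apply: nmin; apply/asboolP.
Qed.

Lemma word_length0 S x : generates S -> word_length S x = 0%N -> x = 1%g.
Proof.
move=> /(word_lengthP x)[Sx _] x0; move: Sx; rewrite x0.
by case=> w [/size0nil-> _ ->]; rewrite big_nil.
Qed.

Lemma word_dist_ge1 (R : realType) S x y :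
  generates S -> x <> y -> 1 <= word_dist R S x y.
Proof.
move=> genS xy; rewrite /word_dist ler1n lt0n; apply/eqP => /(word_length0 genS).
by move=> /(congr1 (fun z => x * z)%g); rewrite mulgA mulgV mul1g mulg1 => /esym.
Qed.

Lemma word_dist_eq (R : realType) S x : generates S -> word_dist R S x x = 0.
Proof.
move=> /(word_lengthP 1%g)[_ /(_ _ (is_word1 S))].
by rewrite /word_dist mulVg leqn0 => /eqP->.
Qed.

Lemma word_distC (R : realType) S x y :
  generates S -> word_dist R S x y = word_dist R S y x.
Proof.
move=> genS; rewrite /word_dist; congr (_%:R); apply/eqP.
have lV z : (word_length S z <= word_length S z^-1%g)%N.
  apply: (word_lengthP z genS).2; rewrite -{2}[z]invgK.
  by apply: is_wordV; apply: (word_lengthP _ genS).1.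
have e : (y^-1 * x = (x^-1 * y)^-1)%g by rewrite invgM invgK.
by rewrite eqn_leq e lV /= -{2}[(x^-1 * y)%g]invgK lV.
Qed.

Lemma word_dist_triangle (R : realType) S x y z : generates S ->
  word_dist R S x z <= word_dist R S x y + word_dist R S y z.
Proof.
move=> genS; rewrite /word_dist -natrD ler_nat.
apply: (word_lengthP _ genS).2.
have -> : (x^-1 * z = x^-1 * y * (y^-1 * z))%g by rewrite -mulgA mulVKg.
by apply: is_wordM; apply: (word_lengthP _ genS).1.
Qed.

Lemma word_dist_mull (R : realType) S g x y :
  word_dist R S (g * x)%g (g * y)%g = word_dist R S x y.
Proof. by rewrite /word_dist invgM -mulgA mulKg. Qed.

End WordMetric.

Section Compression.
Context {R : realType}.

Definition is_hilbert (V : completeNormedModType R) : Prop :=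
  exists dot : {dot V for idfun}, forall v : V, dot v v = `|v| ^+ 2.

Definition is_action (G : groupType) (X : Type) (act : G -> X -> X) : Prop :=
  (forall x, act 1%g x = x) /\
  (forall g h x, act (g * h)%g x = act g (act h x)).

Definition is_affine_isometry (V : normedModType R) (T : V -> V) : Prop :=
  (exists (L : {linear V -> V}) (b : V), forall v, T v = L v + b) /\
  (forall u v, `|T u - T v| = `|u - v|).

(* The case [x = y] only matters for [a = 0], where the lower bound must be
   read with [0 ^ 0 = 0], while [powR] has [0 `^ 0 = 1]. *)
Definition compression_bounds (X : Type) (d : X -> X -> R)
    (V : normedModType R) (f : X -> V) (a : R) : Prop :=
  exists C1 C2 : R, [/\ 0 < C1, 0 < C2 & forall x y, x <> y ->
    C1 * d x y `^ a <= `|f x - f y| <= C2 * d x y].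

(* On a uniformly discrete metric space the sets below contain [0], so [sup]
   is their least upper bound. *)
Definition compression (X : Type) (d : X -> X -> R) : R :=
  sup [set a : R | 0 <= a <= 1 /\
    exists2 V : completeNormedModType R, is_hilbert V &
    exists f : X -> V, compression_bounds d f a].

Definition equivariant_compression (G : groupType) (X : Type)
    (act : G -> X -> X) (d : X -> X -> R) : R :=
  sup [set a : R | 0 <= a <= 1 /\
    exists2 V : completeNormedModType R, is_hilbert V &
    exists rho : G -> V -> V,
      [/\ is_action rho, (forall g, is_affine_isometry (rho g)) &
      exists2 f : X -> V, (forall g x, f (act g x) = rho g (f x)) &
        compression_bounds d f a]].

End Compression.

Definition group_compression (R : realType) (G : groupType) (T : set G) : R :=
  compression (word_dist R T).

Definition group_equivariant_compression
    (R : realType) (G : groupType) (T : set G) : R :=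
  equivariant_compression (fun g x : G => (g * x)%g) (word_dist R T).

Section Lamps.
Variable H : groupType.

Definition lamps : Type := {fsfun int -> H with 1%g}.

HB.instance Definition _ := Choice.on lamps.

Definition lamps_fun (l : lamps) : int -> H :=
  @fun_of_fsfun int H (fun=> 1%g) l.

Coercion lamps_fun : lamps >-> Funclass.

Implicit Types (l m : lamps) (k n x : int).

Lemma lampsP l m : l =1 m -> l = m.
Proof. by move/fsfunP. Qed.

Lemma lamps_out l x : x \notin finsupp l -> l x = 1%g.
Proof. exact: fsfun_dflt. Qed.

Definition lamps_one : lamps := [fsfun with 1%g].

Definition lamps_mul l m : lamps :=
  [fsfun x in (finsupp l `|` finsupp m)%fset => (l x * m x)%g | 1%g].

Definition lamps_inv l : lamps := [fsfun x in finsupp l => (l x)^-1%g | 1%g].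

Definition lamps_shift n l : lamps :=
  [fsfun x in [fset (y + n)%R | y in finsupp l]%fset => l (x - n) | 1%g].

Definition lamp_at (n : int) (h : H) : lamps :=
  [fsfun x in [fset n]%fset => h | 1%g].

Lemma lamps_oneE x : lamps_one x = 1%g.
Proof. exact: fsfun0E. Qed.

Lemma lamps_mulE l m x : lamps_mul l m x = (l x * m x)%g.
Proof.
rewrite [LHS]fsfun_fun in_fsetU.
case: ifP => // /negbT; rewrite negb_or => /andP[/lamps_out-> /lamps_out->].
by rewrite mulg1.
Qed.

Lemma lamps_invE l x : lamps_inv l x = (l x)^-1%g.
Proof.
rewrite [LHS]fsfun_fun; case: ifP => // /negbT/lamps_out->.
by rewrite invg1.
Qed.

Lemma lamps_shiftE n l x : lamps_shift n l x = l (x - n).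
Proof.
rewrite [LHS]fsfun_fun; case: ifP => // /negbT xl; rewrite lamps_out //.
by apply: contraNN xl => xl; apply/imfsetP; exists (x - n); rewrite //= subrK.
Qed.

Lemma lamp_atE n h x : lamp_at n h x = if x == n then h else 1%g.
Proof. by rewrite [LHS]fsfun_fun in_fset1. Qed.

Fact lamps_mulA : associative lamps_mul.
Proof. by move=> l m p; apply: lampsP => x; rewrite !lamps_mulE mulgA. Qed.

Fact lamps_mul1 : left_id lamps_one lamps_mul.
Proof. by move=> l; apply: lampsP => x; rewrite lamps_mulE lamps_oneE mul1g. Qed.

Fact lamps_mulr1 : right_id lamps_one lamps_mul.
Proof. by move=> l; apply: lampsP => x; rewrite lamps_mulE lamps_oneE mulg1. Qed.

Fact lamps_mulV : left_inverse lamps_one lamps_inv lamps_mul.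
Proof.
by move=> l; apply: lampsP => x; rewrite lamps_mulE lamps_invE lamps_oneE mulVg.
Qed.

Fact lamps_mulrV : right_inverse lamps_one lamps_inv lamps_mul.
Proof.
by move=> l; apply: lampsP => x; rewrite lamps_mulE lamps_invE lamps_oneE mulgV.
Qed.

HB.instance Definition _ := isGroup.Build lamps
  lamps_mulA lamps_mul1 lamps_mulr1 lamps_mulV lamps_mulrV.

Lemma lamps_shift0 l : lamps_shift 0 l = l.
Proof. by apply: lampsP => x; rewrite lamps_shiftE subr0. Qed.

Lemma lamps_shiftD k n l :
  lamps_shift k (lamps_shift n l) = lamps_shift (k + n) l.
Proof. by apply: lampsP => x; rewrite !lamps_shiftE opprD addrA. Qed.

Lemma lamps_shiftM n l m :
  lamps_shift n (l * m)%g = (lamps_shift n l * lamps_shift n m)%g.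
Proof.
by apply: lampsP => x; rewrite lamps_shiftE [LHS]lamps_mulE [RHS]lamps_mulE
  !lamps_shiftE.
Qed.

Lemma lamps_shift1 n : lamps_shift n 1%g = 1%g.
Proof. by apply: lampsP => x; rewrite lamps_shiftE [LHS]lamps_oneE [RHS]lamps_oneE. Qed.

End Lamps.

Section Wreath.
Variable H : groupType.

Definition wreath : Type := (lamps H * int)%type.

HB.instance Definition _ := Choice.on wreath.

Implicit Types g h k : wreath.

Definition wreath_one : wreath := (1%g, 0).

Definition wreath_mul g h : wreath :=
  ((g.1 * lamps_shift g.2 h.1)%g, g.2 + h.2).

Definition wreath_inv g : wreath := (lamps_shift (- g.2) g.1^-1%g, - g.2).

Fact wreath_mulA : associative wreath_mul.
Proof.
by move=> g h k; rewrite /wreath_mul /= lamps_shiftM lamps_shiftD mulgA addrA.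
Qed.

Fact wreath_mul1 : left_id wreath_one wreath_mul.
Proof. by case=> l n; rewrite /wreath_mul /= lamps_shift0 mul1g add0r. Qed.

Fact wreath_mulr1 : right_id wreath_one wreath_mul.
Proof. by case=> l n; rewrite /wreath_mul /= lamps_shift1 mulg1 addr0. Qed.

Fact wreath_mulV : left_inverse wreath_one wreath_inv wreath_mul.
Proof.
by case=> l n; rewrite /wreath_mul /= -lamps_shiftM mulVg lamps_shift1 addNr.
Qed.

Fact wreath_mulrV : right_inverse wreath_one wreath_inv wreath_mul.
Proof.
by case=> l n; rewrite /wreath_mul /= lamps_shiftD subrr lamps_shift0 mulgV.
Qed.

HB.instance Definition _ := isGroup.Build wreath
  wreath_mulA wreath_mul1 wreath_mulr1 wreath_mulV wreath_mulrV.

Definition wreath_of_base (h : H) : wreath := (lamp_at 0 h, 0).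

Definition wreath_s : wreath := (1%g, 1).

Definition wreath_gens (S : set H) : set wreath :=
  wreath_of_base @` S `|` [set wreath_s].

Lemma wreath_mulE g h : (g * h)%g = wreath_mul g h.
Proof. by []. Qed.

Lemma wreath_invE g : g^-1%g = wreath_inv g.
Proof. by []. Qed.

Lemma wreath_base_lampM (l m : lamps H) :
  ((l * m)%g, 0) = (((l, 0) : wreath) * (m, 0))%g :> wreath.
Proof. by rewrite !wreath_mulE /wreath_mul /= lamps_shift0 addr0. Qed.

Lemma wreath_gens_generates (S : set H) :
  generates S -> generates (wreath_gens S).
Proof.
move=> genS; pose W (g : wreath) := exists n, is_word (wreath_gens S) n g.
have WM g h : W g -> W h -> W (g * h)%g.
  by move=> [m wg] [n wh]; exists (m + n)%N; apply: is_wordM.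
have WV g : W g -> W g^-1%g by move=> [n wg]; exists n; apply: is_wordV.
have W1 : W 1%g by exists 0%N; apply: is_word1.
have Ws : W wreath_s by exists 1%N; apply: is_word_gen; right.
have lampM (h k : H) : lamp_at 0 (h * k)%g = (lamp_at 0 h * lamp_at 0 k)%g.
  apply: lampsP => x; rewrite [RHS]lamps_mulE !lamp_atE.
  by case: ifP; rewrite ?mulg1.
have lamp1 n : lamp_at n 1%g = 1%g :> lamps H.
  by apply: lampsP => x; rewrite lamp_atE [RHS]lamps_oneE if_same.
have base1 : wreath_of_base 1%g = 1%g by rewrite /wreath_of_base lamp1.
have baseM (h k : H) : wreath_of_base (h * k)%g
    = (wreath_of_base h * wreath_of_base k)%g.
  by rewrite /wreath_of_base lampM wreath_base_lampM.
have baseV (h : H) : wreath_of_base h^-1%g = (wreath_of_base h)^-1%g.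
  apply: (@mulIg wreath (wreath_of_base h)).
  by rewrite -baseM !mulVg base1.
have Wb (h : H) : W (wreath_of_base h).
  have [n [w [_ Sw ->]]] := genS h.
  elim: w Sw => [_|a w IHw Sw]; first by rewrite big_nil base1.
  rewrite big_cons baseM; apply: WM; last first.
    by apply: IHw => b bw; apply: Sw; rewrite inE bw orbT.
  have gen b : S b -> W (wreath_of_base b).
    by move=> Sb; exists 1%N; apply: is_word_gen; left; exists b.
  have [/gen//|/gen/WV] := Sw a (mem_head _ _).
  by rewrite -baseV invgK.
pose t n : wreath := (1%g, n).
have tV : (t 1%R)^-1%g = t (- 1).
  by rewrite wreath_invE /wreath_inv /= invg1 lamps_shift1.
have tM (m k : int) : (t m * t k)%g = t (m + k).
  by rewrite wreath_mulE /wreath_mul /= lamps_shift1 mulg1.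
have Wt (n : int) : W (t n).
  elim/int_ind: n => [|n IHn|n IHn]; first exact: W1.
    by rewrite -addn1 PoszD -tM; apply: WM.
  by rewrite -addn1 PoszD opprD -tM -tV; apply: WM => //; apply: WV.
have Wat n (h : H) : W (lamp_at n h, 0).
  have -> : (lamp_at n h, 0) = (t n * wreath_of_base h * t (- n)%R)%g.
    rewrite !wreath_mulE /wreath_mul /= addr0 subrr lamps_shift1 mulg1 mul1g.
    congr (_, _); apply: lampsP => x; rewrite lamps_shiftE !lamp_atE.
    by rewrite subr_eq0.
  by apply: (WM) => //; apply: WM.
have Wl (l : lamps H) : W (l, 0).
  elim: {l}(#|` finsupp l|%fset) {-2}l (leqnn #|` finsupp l|%fset) => [|k IHk] l.
    rewrite leqn0 cardfs_eq0 => /eqP lE.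
    suff -> : l = 1%g by exact: W1.
    by apply: lampsP => x; rewrite [RHS]lamps_oneE lamps_out // lE in_fset0.
  case: (fset_0Vmem (finsupp l)) => [l0 _|[n nl] lk].
    suff -> : l = 1%g by exact: W1.
    by apply: lampsP => x; rewrite [RHS]lamps_oneE lamps_out // l0 in_fset0.
  pose m : lamps H := [fsfun l without n].
  have mE x : m x = if x == n then 1%g else l x by exact: fsfun_withE.
  have -> : l = (lamp_at n (l n) * m)%g.
    apply: lampsP => x; rewrite [RHS]lamps_mulE lamp_atE mE.
    by case: eqP => [->|_]; rewrite ?mulg1 ?mul1g.
  rewrite wreath_base_lampM; apply: (WM) => //; apply: IHk.
  by move: lk; rewrite (finsupp_without _ _ n) [X in (X <= _)%N -> _](cardfsD1 n) nl add1n ltnS.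
case=> l n; have -> : (l, n) = (((l, 0) : wreath) * t n)%g.
  by rewrite !wreath_mulE /wreath_mul /= lamps_shift1 mulg1 add0r.
exact: WM.
Qed.

End Wreath.

(* Main.v *)
Require Import Defs.
From HB Require Import structures.
From mathcomp Require Import all_boot all_order all_algebra finmap ring lra zify.
From mathcomp Require Import all_classical all_reals all_analysis.

(** Both lower bounds follow from one statement, valid in the plain and in the
equivariant setting: the compression of [Gamma] is at least
[min (r, 1/2)], where [r] is that of [H].  Indeed [x / (x + 1)],
[x - 1/2] and [x / (2 x + 1)] are all at most [min (x, 1/2)] on [[0, 1]].  The
upper bounds hold because [H], the copy of index 0, is isometrically embedded
in [Gamma]: a map on [Gamma] and an affine action of [Gamma] restrict to [H].

For the lower bound let [F : H -> V] have compression exponent [a], with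
[0 < a <= 1/2].  An element [g = (l, n)] of [Gamma] is sent to the family
[profile F g] that consists of the vectors [F (l x)], for [x] in [Z], and of
the truth values of [g \in A], for [A] in a collection of subsets of [Gamma]
called half-spaces.  These are the sides of the edges of two trees on which
[Gamma] acts: the vertices of the first are the pairs of a position [n] and of
a configuration of the lamps to the right of [n], and the second is its mirror
image.  The number of half-spaces that separate two elements is comparable to
the length of the walk that the cursor has to make between them.

A family [profile F g] is not square summable, but the difference of two of
them is: a generator changes only one vector [F (l x)], by a bounded amount, or
two truth values ([profile_gen]).  Hence [g |-> profile F g - profile F 1] is a
Lipschitz map to a Hilbert sum of copies of [V] and of the real line
([hsum_map_lipschitz]).  If [F] is equivariant, [Gamma] acts on the families,
by [H] on each copy of [V] and by permuting the indices, and [profile F] is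
equivariant; moving the origin to [profile F 1] turns this into an action on
the Hilbert sum ([hsum_map_affine]), which is affine since every isometry of a
Hilbert space is ([isometry_affine]).

It remains to bound the squared distance from below ([profile_lower]).  Let [K]
be the least integer such that [g^-1 h = (v, p)] has [|p| <= K] and [v]
supported in [[-K, K]].  At least [K] half-spaces separate [g] from [h]
([extent_separated]), so the squared distance is at least a multiple of
[K + sum_x |v x| ^ (2 a)].  On the other hand walking to [-K], then to [K + 1]
while setting the lamps, and back to [p], shows that the distance from [g] to
[h] is at most [5 K + 2 + sum_x |v x|] ([wreath_length_le]).  As [2 a <= 1], the
power [2 a] is subadditive, and the distance to the power [2 a] is at most a
multiple of the squared distance of the images ([powR_word_bound]). *)

Set Implicit Arguments.
Unset Strict Implicit.
Unset Printing Implicit Defensive.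

Import Order.TTheory GRing.Theory Num.Theory.
Import numFieldNormedType.Exports.

Local Open Scope classical_set_scope.
Local Open Scope ring_scope.

(** * Inner products on Hilbert spaces *)

Lemma hilbert_form (R : realType) (V : completeNormedModType R) :
  is_hilbert V -> exists b : V -> V -> R,
    [/\ forall u v, b u v = b v u,
        forall u v w, b (u + v) w = b u w + b v w,
        forall k u w, b (k *: u) w = k * b u w &
        forall v, b v v = `|v| ^+ 2].
Proof.
case=> dot dotE; exists dot; split=> //.
- by move=> u v; rewrite [LHS]hermitian_subproof expr0 mul1r.
- by move=> u v w; rewrite linearDl.
- by move=> k u w; rewrite linearZl_LR.
Qed.

Lemma is_hilbert_form (R : realType) (V : completeNormedModType R)
    (b : V -> V -> R) :
  (forall u v, b u v = b v u) ->
  (forall u v w, b (u + v) w = b u w + b v w) ->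
  (forall k u w, b (k *: u) w = k * b u w) ->
  (forall v, b v v = `|v| ^+ 2) -> is_hilbert V.
Proof.
move=> bC bD bZ bE.
have bil : bilinear_for ( *%R : GRing.Scale.law R R)
    ((idfun \; *%R) : GRing.Scale.law R R) b.
  split=> [w k u v|w k u v] /=; first by rewrite bD bZ.
  by rewrite ![b w _]bC bD bZ.
pose B := bilinear_isBilinear.Build _ _ _ _ _ _ b bil.
have herm u v : b u v = (-1) ^+ false * idfun (b v u).
  by rewrite expr0 mul1r bC.
pose Hm := isHermitianSesquilinear.Build R V false idfun b herm.
have pos u : u != 0 -> 0 < b u u by move=> u0; rewrite bE exprn_gt0 ?normr_gt0.
pose D := isDotProduct.Build R V b pos.
pose dot : {dot V for idfun} := HB.pack b B Hm D.
by exists dot.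
Qed.

Lemma realType_hilbert (R : realType) : is_hilbert (R^o : completeNormedModType R).
Proof.
apply: (@is_hilbert_form R R^o (fun u v : R => u * v)).
- by move=> u v; rewrite mulrC.
- by move=> u v w; rewrite mulrDl.
- by move=> k u w; rewrite mulrA.
- by move=> v; rewrite real_normK ?num_real// expr2.
Qed.

(** * The Hilbert sum of a family of Hilbert spaces *)

Lemma esumZl (R : realType) (I : choiceType) (c : R) (a : I -> \bar R) :
  0 <= c -> (forall i, (0 <= a i)%E) ->
  \esum_(i in [set: I]) (c%:E * a i)%E = (c%:E * \esum_(i in [set: I]) a i)%E.
Proof.
have le k (b : I -> \bar R) : 0 <= k -> (forall i, (0 <= b i)%E) ->
    (\esum_(i in [set: I]) (k%:E * b i) <= k%:E * \esum_(i in [set: I]) b i)%E.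
  move=> k0 b0; apply: ge_ereal_sup => _ [X [finX _] <-].
  rewrite -ge0_mule_fsumr//; apply: lee_wpmul2l; first by rewrite lee_fin.
  by apply: esum_ge; exists X.
move=> c0 a0; apply/eqP; rewrite eq_le le//=.
have [->|cN0] := eqVneq c 0.
  by rewrite mul0e esum_ge0// => i _; rewrite mul0e.
have c'0 : 0 <= c^-1 by rewrite invr_ge0.
have cE0 : (0 <= c%:E)%E by rewrite lee_fin.
have := le _ (fun i => c%:E * a i)%E c'0 (fun i => mule_ge0 cE0 (a0 i)).
under eq_esum do rewrite muleA -EFinM mulVf// mul1e.
move/(lee_wpmul2l (x := c%:E)) => /(_ cE0).
by rewrite muleA -EFinM mulfV// mul1e.
Qed.

Section SquareSum.
Variables (R : realType) (I : choiceType) (V : I -> completeNormedModType R).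
Implicit Types u v : forall i, V i.

Definition sqn u : \bar R := \esum_(i in [set: I]) (`|u i| ^+ 2)%:E.

Lemma sqn_ge0 u : (0 <= sqn u)%E.
Proof. by apply: esum_ge0 => i _; rewrite lee_fin sqr_ge0. Qed.

Lemma sqn_ge u (r : seq I) : uniq r ->
  ((\sum_(i <- r) `|u i| ^+ 2)%:E <= sqn u)%E.
Proof.
move=> ru; apply: esum_ge; exists [set` r]; first by split=> //.
by rewrite -sumEFin fsbig_seq.
Qed.

Lemma sqn_le u (c : R) :
  (forall r : seq I, uniq r -> \sum_(i <- r) `|u i| ^+ 2 <= c) ->
  (sqn u <= c%:E)%E.
Proof.
move=> uc; apply: ge_ereal_sup => _ [X [finX _] <-].
by rewrite fsbig_finite//= sumEFin lee_fin; apply: uc.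
Qed.

Lemma eq_sqn u v : (forall i, `|u i| = `|v i|) -> sqn u = sqn v.
Proof. by move=> uv; apply: eq_esum => i _; rewrite uv. Qed.

Lemma sqnZ (k : R) u : sqn (fun i => k *: u i) = ((k ^+ 2)%:E * sqn u)%E.
Proof.
rewrite -esumZl ?sqr_ge0//; apply: eq_esum => i _.
by rewrite normrZ exprMn real_normK ?num_real// EFinM.
Qed.

Lemma sqnD_le u v :
  (sqn (fun i => u i + v i)%R <= 2%:E * sqn u + 2%:E * sqn v)%E.
Proof.
have sq0 w i : (0 <= (`|w i : V i| ^+ 2)%:E)%E by rewrite lee_fin sqr_ge0.
rewrite -!esumZl// -esumD; last 2 first.
- by move=> i _; apply: mule_ge0.
- by move=> i _; apply: mule_ge0.
apply: le_esum => i _; rewrite -!EFinM -EFinD lee_fin.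
have := ler_normD (u i) (v i); have := normr_ge0 (u i + v i).
have := sqr_ge0 (`|u i| - `|v i|); nra.
Qed.

Lemma sqnD_fin u v : (sqn u < +oo -> sqn v < +oo ->
  sqn (fun i => u i + v i)%R < +oo)%E.
Proof.
move=> uoo voo; apply: le_lt_trans (sqnD_le u v) _.
by rewrite lte_add_pinfty// lte_mul_pinfty.
Qed.

Lemma sqnZ_fin (k : R) u : (sqn u < +oo -> sqn (fun i => k *: u i)%R < +oo)%E.
Proof. by move=> uoo; rewrite sqnZ lte_mul_pinfty ?lee_fin ?sqr_ge0. Qed.

Lemma sqnN_fin u : (sqn u < +oo -> sqn (fun i => - u i)%R < +oo)%E.
Proof. by rewrite (@eq_sqn (fun i => - u i) u)// => i; rewrite normrN. Qed.

Lemma sqn0 : sqn (fun i => 0) = 0%E.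
Proof. by apply: esum1 => i _; rewrite normr0 expr0n. Qed.

End SquareSum.

Section HilbertSum.
Variables (R : realType) (I : choiceType) (V : I -> completeNormedModType R).

Record hsum (hV : forall i, is_hilbert (V i)) := HSum {
  hval :> forall i, V i;
  hval_fin : (sqn hval < +oo)%E }.

Variable hV : forall i, is_hilbert (V i).
Local Notation W := (hsum hV).
Implicit Types u v w : W.

Lemma hsumP u v : (forall i, u i = v i) -> u = v.
Proof.
case: u v => [u uP] [v vP] /= uv; have e : u = v by apply: functional_extensionality_dep.
by case: _ / e vP {uv} => vP; congr HSum; apply: Prop_irrelevance.
Qed.

HB.instance Definition _ := gen_eqMixin W.
HB.instance Definition _ := gen_choiceMixin W.

Definition hsum0 : W := @HSum hV (fun=> 0) (eq_ind_r (fun x => x < +oo)%E (ltry 0) (sqn0 V)).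
Definition hsumD u v : W := HSum hV (sqnD_fin (hval_fin u) (hval_fin v)).
Definition hsumN u : W := HSum hV (sqnN_fin (hval_fin u)).
Definition hsumZ (k : R) u : W := HSum hV (sqnZ_fin k (hval_fin u)).

Fact hsumA : associative hsumD.
Proof. by move=> u v w; apply: hsumP => i /=; rewrite addrA. Qed.
Fact hsumC : commutative hsumD.
Proof. by move=> u v; apply: hsumP => i /=; rewrite addrC. Qed.
Fact hsum0D : left_id hsum0 hsumD.
Proof. by move=> u; apply: hsumP => i /=; rewrite add0r. Qed.
Fact hsumND : left_inverse hsum0 hsumN hsumD.
Proof. by move=> u; apply: hsumP => i /=; rewrite addNr. Qed.

HB.instance Definition _ := GRing.isZmodule.Build W hsumA hsumC hsum0D hsumND.

Fact hsumZA (a b : R) u : hsumZ a (hsumZ b u) = hsumZ (a * b) u.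
Proof. by apply: hsumP => i /=; rewrite scalerA. Qed.
Fact hsum1Z : left_id 1 hsumZ.
Proof. by move=> u; apply: hsumP => i /=; rewrite scale1r. Qed.
Fact hsumZDr : right_distributive hsumZ +%R.
Proof. by move=> k u v; apply: hsumP => i /=; rewrite scalerDr. Qed.
Fact hsumZDl u : {morph hsumZ^~ u : a b / a + b}.
Proof. by move=> a b; apply: hsumP => i /=; rewrite scalerDl. Qed.

HB.instance Definition _ :=
  GRing.Zmodule_isLmodule.Build R W hsumZA hsum1Z hsumZDr hsumZDl.

Definition hsq u : R := fine (sqn u).

Lemma hsqE u : (hsq u)%:E = sqn u.
Proof. by rewrite fineK// ge0_fin_numE ?sqn_ge0// hval_fin. Qed.

Lemma hsq_ge0 u : 0 <= hsq u.
Proof. by rewrite fine_ge0// sqn_ge0. Qed.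

Lemma hsqZ k u : hsq (k *: u) = k ^+ 2 * hsq u.
Proof. by apply: EFin_inj; rewrite EFinM !hsqE sqnZ. Qed.

Lemma hsq_coord u i : `|u i| ^+ 2 <= hsq u.
Proof.
have /(sqn_ge u) : uniq [:: i] by [].
by rewrite -hsqE lee_fin big_seq1.
Qed.

Lemma hsq_eq0 u : hsq u = 0 -> u = 0.
Proof.
move=> u0; apply: hsumP => i; apply/eqP; rewrite -normr_eq0 -sqrf_eq0.
by rewrite eq_le sqr_ge0 andbT -u0 hsq_coord.
Qed.

(** The infinite sums are additive on families of nonnegative terms only, so a
relation between squared norms is written with nonnegative coefficients on both
sides.  It then passes from the summands to the Hilbert sum, and this is how the
bilinearity of [hdot] is obtained without summing families of varying sign. *)
Lemma hsq_relation (r s : seq (R * W)) :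
  all (fun p => 0 <= p.1) (r ++ s) ->
  (forall i, \sum_(p <- r) p.1 * `|p.2 i| ^+ 2 = \sum_(p <- s) p.1 * `|p.2 i| ^+ 2) ->
  \sum_(p <- r) p.1 * hsq p.2 = \sum_(p <- s) p.1 * hsq p.2.
Proof.
have esumE (t : seq (R * W)) : (forall p, p \in t -> 0 <= p.1) ->
    \esum_(i in [set: I]) (\sum_(p <- t) p.1 * `|p.2 i| ^+ 2)%:E
    = (\sum_(p <- t) p.1 * hsq p.2)%:E.
  move=> t0; rewrite -sumEFin big_seq.
  under [RHS]eq_bigr => p pt.
    rewrite EFinM hsqE -esumZl ?t0//; over.
  rewrite -esum_sum; last first.
    by move=> i p _ pt; rewrite -EFinM lee_fin mulr_ge0 ?t0 ?sqr_ge0.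
  by apply: eq_esum => i _; rewrite -sumEFin [LHS]big_seq; apply: eq_bigr.
move=> /allP rs0 rs; apply: EFin_inj; rewrite -!esumE.
- by apply: eq_esum => i _; rewrite rs.
- by move=> p ps; rewrite rs0// mem_cat ps orbT.
- by move=> p ps; rewrite rs0// mem_cat ps.
Qed.

(** Polarization: only sums of nonnegative terms occur in this formula for the
inner product. *)
Definition hdot u v : R := (hsq (u + v) - hsq u - hsq v) / 2.

Lemma hdotC u v : hdot u v = hdot v u.
Proof. by rewrite /hdot [v + u]addrC; lra. Qed.

Lemma hdotDl u v w : hdot (u + v) w = hdot u w + hdot v w.
Proof.
have /= := @hsq_relation [:: (1, u + v + w); (1, u); (1, v); (1, w)]
  [:: (1, u + w); (1, v + w); (1, u + v)].
rewrite !(big_cons, big_nil) /= => H; rewrite /hdot.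
suff: hsq (u + v + w) + hsq u + hsq v + hsq w
  = hsq (u + w) + hsq (v + w) + hsq (u + v) by lra.
rewrite !mul1r !addr0 !addrA in H; apply: H.
  by rewrite /= !ler01.
move=> i; rewrite !(big_cons, big_nil) /= !mul1r !addr0.
have [b [bC bD _ bE]] := hilbert_form (hV i).
rewrite -!bE !bD ![b _ (_ + _)]bC !bD.
rewrite [b (v i) (u i)]bC [b (w i) (u i)]bC [b (w i) (v i)]bC; lra.
Qed.

Lemma hdotZl k u w : hdot (k *: u) w = k * hdot u w.
Proof.
(* [hsq_relation] needs nonnegative coefficients, hence the positive part [p]
   and the negative part [m] of [k]. *)
pose p := Num.max k 0; pose m := Num.max (- k) 0.
have p0 : 0 <= p by rewrite le_max lexx orbT.
have m0 : 0 <= m by rewrite le_max lexx orbT.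
have kE : k = p - m.
  rewrite /p /m /Num.max; case: ifP; case: ifP; rewrite ?oppr_lt0 //; lra.
have := @hsq_relation [:: (1, k *: u + w); (m, u + w); (p, u); (p, w)]
  [:: (p, u + w); (m, u); (m, w); (k ^+ 2, u); (1, w)].
rewrite !(big_cons, big_nil) /= => H; rewrite /hdot hsqZ.
suff: 1 * hsq (k *: u + w) + (m * hsq (u + w) + (p * hsq u + (p * hsq w + 0)))
  = p * hsq (u + w) + (m * hsq u + (m * hsq w + (k ^+ 2 * hsq u + (1 * hsq w + 0)))).
  by rewrite kE; lra.
apply: H.
  by rewrite /= !ler01 !m0 !p0 !sqr_ge0.
move=> i; rewrite !(big_cons, big_nil) /= !mul1r !addr0.
have [b [bC bD bZ bE]] := hilbert_form (hV i).
rewrite -!bE !bD ![b _ (_ + _)]bC !bD !bZ ![b _ (_ *: _)]bC !bZ [b (w i) (u i)]bC.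
rewrite kE; ring.
Qed.

Lemma hdotE u : hdot u u = hsq u.
Proof. by rewrite /hdot -[u + u](_ : 2 *: u = _) ?hsqZ ?scaler_nat//; lra. Qed.

(** Expand [0 <= hsq (hsq v *: u - hdot u v *: v)], which is [hsq v] times the
difference of the two sides. *)
Lemma hdot_CauchySchwarz u v : hdot u v ^+ 2 <= hsq u * hsq v.
Proof.
have [v0|vN0] := eqVneq (hsq v) 0.
  rewrite (hsq_eq0 v0) /hdot addr0 [hsq 0](_ : _ = 0); first by lra.
  by rewrite -(scale0r u) hsqZ; lra.
have v_gt0 : 0 < hsq v by rewrite lt0r vN0 hsq_ge0.
have := hsq_ge0 (hsq v *: u + (- hdot u v) *: v).
have Dr x y z : hdot x (y + z) = hdot x y + hdot x z.
  by rewrite hdotC hdotDl !(hdotC x).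
have Zr k x y : hdot x (k *: y) = k * hdot x y by rewrite hdotC hdotZl (hdotC x).
rewrite -hdotE !(hdotDl, Dr, hdotZl, Zr) [hdot v u]hdotC !hdotE.
set d := hdot u v; set a := hsq u; set c := hsq v in v_gt0 *.
rewrite [X in 0 <= X](_ : _ = c * (a * c - d ^+ 2)); last by ring.
by rewrite pmulr_rge0// subr_ge0.
Qed.

Definition hnorm u : R := Num.sqrt (hsq u).

Lemma hnormD u v : hnorm (u + v) <= hnorm u + hnorm v.
Proof.
have n0 w : 0 <= hnorm w by apply: sqrtr_ge0.
rewrite -(@ler_pXn2r _ 2)// ?nnegrE ?addr_ge0//.
rewrite sqrrD !sqr_sqrtr ?hsq_ge0//.
have -> : hsq (u + v) = hsq u + hdot u v *+ 2 + hsq v.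
  by rewrite /hdot mulr2n; lra.
rewrite lerD2r lerD2l ler_pMn2r// -sqrtrM ?hsq_ge0//.
rewrite (le_trans (ler_norm _))// -sqrtr_sqr ler_wsqrtr//.
exact: hdot_CauchySchwarz.
Qed.

Lemma hnormZ (k : R) u : hnorm (k *: u) = `|k| * hnorm u.
Proof. by rewrite /hnorm hsqZ sqrtrM ?sqr_ge0// sqrtr_sqr. Qed.

Lemma hnorm_eq0 u : hnorm u = 0 -> u = 0.
Proof.
move/eqP; rewrite sqrtr_eq0 => u0; apply: hsq_eq0.
by apply/eqP; rewrite eq_le u0 hsq_ge0.
Qed.

HB.instance Definition _ :=
  @Lmodule_isNormed.Build R W hnorm hnormD hnormZ hnorm_eq0.

Lemma hsum_normE u : `|u| = hnorm u. Proof. by []. Qed.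

Lemma hsum_norm2 u : (`|u| ^+ 2)%:E = sqn u.
Proof. by rewrite hsum_normE sqr_sqrtr ?hsq_ge0 ?hsqE. Qed.

Lemma hsum_coord u i : `|u i| <= `|u|.
Proof.
rewrite -(@ler_pXn2r _ 2)// ?nnegrE// -lee_fin hsum_norm2 -hsqE lee_fin.
exact: hsq_coord.
Qed.

End HilbertSum.

Section HilbertSumComplete.
Variables (R : realType) (I : choiceType) (V : I -> completeNormedModType R).
Variable hV : forall i, is_hilbert (V i).
Local Notation W := (hsum hV).

(** The limit is taken coordinatewise.  On a ball of the filter of radius [e], the
finite partial sums of the squared distance to the centre are at most [e ^ 2];
this bound survives the limit in finitely many coordinates, and is uniform in
the finite set.  It shows both that the limit is square summable and that the
filter converges to it. *)
Lemma hsum_complete (F : set_system W) : ProperFilter F -> cauchy F -> cvg F.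
Proof.
move=> FF /cauchyP Fc.
have cvgi i : cvg ((fun u : W => u i) @ F).
  apply: cauchy_cvg; apply: cauchy_exP => e /Fc[x Fx]; exists (x i).
  suff : F [set u | ball (x i) e (u i)] by [].
  apply: filterS Fx => u /=; rewrite -!ball_normE /ball_ /=; apply: le_lt_trans.
  exact: (hsum_coord (x - u) i).
pose l i : V i := lim ((fun u : W => u i) @ F).
have dist_l (e : R) (x : W) : 0 < e -> F (ball x e) ->
    (sqn (fun i => x i - l i)%R <= (e ^+ 2)%:E)%E.
  move=> e0 Fx; apply: sqn_le => r ru.
  pose g (u : W) : R := \sum_(i <- r) `|x i - u i| ^+ 2.
  have gl : g u @[u --> F] --> \sum_(i <- r) `|x i - l i| ^+ 2.
    apply: (@cvg_big _ _ +%R) => [|i _]; first exact: add_continuous.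
    have xl : `|x i - u i| @[u --> F] --> `|x i - l i|.
      by apply: cvg_norm; apply: cvgB; [exact: cvg_cst|exact: cvgi].
    by rewrite expr2; apply: (cvgM xl xl).
  apply: (cvgr_to_le gl); apply: filterS Fx => u.
  rewrite -ball_normE /ball_ /= => /ltW xu.
  rewrite -lee_fin; apply: le_trans (sqn_ge (x - u) ru) _.
  by rewrite -hsum_norm2 lee_fin ler_pXn2r// ?nnegrE// ltW.
have lP : (sqn l < +oo)%E.
  have [x Fx] := Fc 1 ltr01.
  have xl := le_lt_trans (dist_l _ _ ltr01 Fx) (ltry _).
  rewrite (_ : l = fun i => x i + - (x i - l i)); last first.
    by apply: functional_extensionality_dep => i; rewrite opprB addrC subrK.
  exact: sqnD_fin (hval_fin x) (sqnN_fin xl).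
apply/cvg_ex; exists (HSum hV lP); apply/cvgrPdist_le => e e0.
have e20 : 0 < e / 2 by rewrite divr_gt0.
have [x Fx] := Fc _ e20.
have xl : `|x - HSum hV lP| <= e / 2.
  rewrite -(@ler_pXn2r _ 2)// ?nnegrE ?(ltW e20)// -lee_fin hsum_norm2.
  exact: dist_l Fx.
apply: filterS Fx => u; rewrite -ball_normE /ball_ /= => /ltW xu.
rewrite [leRHS]splitr (le_trans (ler_distD x _ _))// lerD//.
by rewrite distrC.
Qed.

HB.instance Definition _ := Uniform_isComplete.Build W hsum_complete.

Lemma hsum_hilbert : is_hilbert W.
Proof.
apply: (@is_hilbert_form R W (@hdot R I V hV)).
- exact: hdotC.
- exact: hdotDl.
- exact: hdotZl.
- by move=> v; apply: EFin_inj; rewrite hdotE hsqE hsum_norm2.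
Qed.

End HilbertSumComplete.

(** * Affine isometric actions on Hilbert sums *)

(** A distance preserving map [L] with [L 0 = 0] preserves inner products.  Then
[|L (k u + v) - k L u - L v| ^ 2] expands to the same expression as for the
identity map, namely 0. *)
Lemma isometry_affine (R : realType) (V : completeNormedModType R) (T : V -> V) :
  is_hilbert V -> (forall u v, `|T u - T v| = `|u - v|) -> is_affine_isometry T.
Proof.
move=> /hilbert_form[b [bC bD bZ bE]] Tiso; split=> //.
have bN u v : b (- u) v = - b u v by rewrite -scaleN1r bZ mulN1r.
have bDr u v w : b u (v + w) = b u v + b u w by rewrite bC bD !(bC _ u).
have bZr k u v : b u (k *: v) = k * b u v by rewrite bC bZ (bC v).
have bNr u v : b u (- v) = - b u v by rewrite bC bN (bC v).
have [L LT] : exists L, forall v, L v = T v - T 0 by exists (fun v => T v - T 0).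
have LE u v : b (L u) (L v) = b u v.
  have Lb w : b (L w) (L w) = b w w by rewrite !bE LT Tiso subr0.
  have : b (L u - L v) (L u - L v) = b (u - v) (u - v).
    by rewrite !bE -(Tiso u v) !LT opprB addrA subrK.
  rewrite !(bD, bDr, bN, bNr) !Lb (bC (L v)) (bC v u); lra.
have Llin : linear L.
  move=> k u v; apply/eqP; rewrite -subr_eq0 -normr_eq0 -sqrf_eq0 -bE.
  apply/eqP; rewrite !(bD, bDr, bN, bNr, bZ, bZr) !LE.
  by rewrite !(bD, bDr, bN, bNr, bZ, bZr); ring.
pose LL : {linear V -> V} := HB.pack L (GRing.isLinear.Build _ _ _ _ L Llin).
by exists LL, (T 0) => v; rewrite /= LT subrK.
Qed.

Section AffineOrbit.
Variables (R : realType) (I : choiceType) (V : I -> completeNormedModType R).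
Variable hV : forall i, is_hilbert (V i).
Variables (G : groupType) (Phi : G -> forall i, V i).
Hypothesis Phi_fin : forall g h, (sqn (fun i => Phi g i - Phi h i)%R < +oo)%E.

(** The families [Phi g] need not be square summable, only their differences are:
they lie in one affine space over the Hilbert sum, whose origin is put at
[Phi 1]. *)
Definition hsum_map g : hsum hV := HSum hV (Phi_fin g 1%g).

Lemma hsum_map_dist g h :
  (`|hsum_map g - hsum_map h| ^+ 2)%:E = sqn (fun i => Phi g i - Phi h i)%R.
Proof.
by rewrite hsum_norm2; apply: eq_sqn => i /=; rewrite opprB addrA subrK.
Qed.

Variable pi : G -> (forall i, V i) -> forall i, V i.
Hypothesis pi1 : forall u, pi 1%g u = u.
Hypothesis piM : forall g h u, pi (g * h)%g u = pi g (pi h u).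
Hypothesis pi_iso : forall g u v,
  sqn (fun i => pi g u i - pi g v i)%R = sqn (fun i => u i - v i)%R.
Hypothesis piPhi : forall g h, Phi (g * h)%g = pi g (Phi h).

(** If the action [pi] on all families preserves distances and makes [Phi]
equivariant, it preserves the affine space of the families at finite distance
from [Phi 1]; translating the origin of that space to [Phi 1] gives the action
[w |-> pi g (Phi 1 + w) - Phi 1]. *)
Lemma hsum_map_affine : exists rho : G -> hsum hV -> hsum hV,
  [/\ is_action rho, forall g, is_affine_isometry (rho g) &
      forall g h, hsum_map (g * h)%g = rho g (hsum_map h)].
Proof.
pose base (w : hsum hV) : forall i, V i := fun i => Phi 1%g i + w i.
have rho_fin g w : (sqn (fun i => pi g (base w) i - Phi 1%g i)%R < +oo)%E.
  pose d i := (pi g (base w) i - pi g (Phi 1%g) i) + (Phi g i - Phi 1%g i).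
  rewrite (@eq_sqn _ _ _ _ d); last first.
    by move=> i; rewrite /d -piPhi mulg1 addrA subrK.
  apply: sqnD_fin => //; rewrite pi_iso.
  rewrite (@eq_sqn _ _ _ _ w) ?hval_fin// => i.
  by rewrite /base addrC addKr.
pose rho g w := HSum hV (rho_fin g w).
have base_rho g w : base (rho g w) = pi g (base w).
  by apply: functional_extensionality_dep => i; rewrite /base /= addrC subrK.
have base_map h : base (hsum_map h) = Phi h.
  by apply: functional_extensionality_dep => i; rewrite /base /= addrC subrK.
have basei (u w : hsum hV) : base u = base w -> u = w.
  move=> uw; apply: hsumP => i.
  by have /(congr1 (fun f => f i))/addrI := uw.
exists rho; split.
- by split=> [w|g h w]; apply: basei; rewrite !base_rho ?pi1 ?piM.
- move=> g; apply: isometry_affine; first exact: hsum_hilbert.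
  move=> u v; apply/eqP; rewrite -(@eqrXn2 _ 2)//.
  apply/eqP; apply: EFin_inj; rewrite !hsum_norm2.
  transitivity (sqn (fun i => pi g (base u) i - pi g (base v) i)%R).
    by apply: eq_sqn => i /=; rewrite opprB addrA subrK.
  rewrite pi_iso; apply: eq_sqn => i.
  by rewrite /base /= opprD addrACA subrr add0r.
- by move=> g h; apply: basei; rewrite base_rho !base_map.
Qed.

End AffineOrbit.

(** * Word lengths *)

Section Words.
Variables (G : groupType) (T : set G).
Implicit Types (x y : G) (n : nat).

Lemma word_length_le x n : generates T -> is_word T n x -> (word_length T x <= n)%N.
Proof. by move=> genT; apply: (word_lengthP x genT).2. Qed.

Lemma is_word_length x : generates T -> is_word T (word_length T x) x.
Proof. by move=> genT; apply: (word_lengthP x genT).1. Qed.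

Lemma is_word_ind (P : nat -> G -> Prop) :
  P 0%N 1%g ->
  (forall a n x, T a \/ T a^-1%g -> P n x -> P n.+1 (a * x)%g) ->
  forall n x, is_word T n x -> P n x.
Proof.
move=> P0 PS n x [w [<- Tw ->]]; elim: w Tw => [|a w IHw] Tw.
  by rewrite big_nil.
rewrite big_cons /=; apply: PS; first exact/Tw/mem_head.
by apply: IHw => b bw; apply: Tw; rewrite inE bw orbT.
Qed.

End Words.

(** * Lipschitz maps to Hilbert sums *)

Section LipschitzOrbit.
Variables (R : realType) (I : choiceType) (V : I -> completeNormedModType R).
Variable hV : forall i, is_hilbert (V i).
Variables (G : groupType) (T : set G) (Phi : G -> forall i, V i) (c : R).
Hypothesis genT : generates T.
Hypothesis c_ge0 : 0 <= c.
Hypothesis Phi_gen : forall g a, T a ->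
  (sqn (fun i => Phi (g * a)%g i - Phi g i)%R <= (c ^+ 2)%:E)%E.

Let Phi_letter g a : T a \/ T a^-1%g ->
  (sqn (fun i => Phi (g * a)%g i - Phi g i)%R <= (c ^+ 2)%:E)%E.
Proof.
move=> [/Phi_gen//|/(Phi_gen (g * a)%g)]; rewrite mulgK; apply: le_trans.
by rewrite le_eqVlt; apply/orP; left; apply/eqP/eq_sqn => i; rewrite distrC.
Qed.

(** A path of generators joins [h] to [g], and square summable families form a
group. *)
Lemma sqn_orbit_fin g h : (sqn (fun i => Phi g i - Phi h i)%R < +oo)%E.
Proof.
have [n] := genT (h^-1 * g)%g; rewrite -[in Phi g](mulVKg h g).
move: (h^-1 * g)%g => x Tx; move: n x Tx h; apply: is_word_ind.
  by move=> h; rewrite (@eq_sqn _ _ _ _ (fun=> 0)) ?sqn0 ?ltry// => i; rewrite mulg1 subrr.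
move=> a n x Ta IH h.
rewrite (_ : (fun i => _) = fun i =>
    (Phi (h * a * x)%g i - Phi (h * a)%g i) + (Phi (h * a)%g i - Phi h i)); last first.
  by apply: functional_extensionality_dep => i; rewrite mulgA addrA subrK.
by apply: sqnD_fin => //; apply: le_lt_trans (Phi_letter _ Ta) (ltry _).
Qed.

(** Along a word, each letter moves the image by at most [c]; the set of
generators may be infinite, so the uniform bound of [Phi_gen] matters. *)
Lemma hsum_map_lipschitz
    (fin : forall g h, (sqn (fun i => Phi g i - Phi h i)%R < +oo)%E) g h :
  `|hsum_map hV fin g - hsum_map hV fin h| <= c * word_dist R T g h.
Proof.
rewrite (word_distC _ _ _ genT) /word_dist -{1}(mulVKg h g).
move: (is_word_length (h^-1 * g)%g genT).
move: (h^-1 * g)%g => x; move: (word_length T x) => n Tx; move: n x Tx h.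
apply: is_word_ind.
  by move=> h; rewrite mulg1 subrr normr0 mulr0.
move=> a n x Ta IH h; rewrite mulgA.
rewrite (le_trans (ler_distD (hsum_map hV fin (h * a)%g) _ _))//.
rewrite -addn1 natrD mulrDr mulr1 lerD//.
rewrite -(@ler_pXn2r _ 2)// ?nnegrE// -lee_fin hsum_map_dist.
exact: Phi_letter.
Qed.

End LipschitzOrbit.

Lemma sqn_le_support (R : realType) (I : choiceType)
    (V : I -> completeNormedModType R) (u : forall i, V i) (r : seq I) (c : R) :
  0 <= c -> (forall i, i \notin r -> u i = 0) -> (forall i, `|u i| ^+ 2 <= c) ->
  (sqn u <= (c * (size r)%:R)%:E)%E.
Proof.
move=> c0 ur uc; apply: sqn_le => s us.
rewrite (bigID (mem r)) /= [X in _ + X]big1 ?addr0; last first.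
  by move=> i /ur ->; rewrite normr0 expr0n.
apply: (@le_trans _ _ (\sum_(i <- s | i \in r) c)); first exact: ler_sum.
rewrite big_const_seq iter_addr_0 -[leLHS]mulr_natr.
apply: ler_wpM2l => //; rewrite ler_nat -size_filter uniq_leq_size ?filter_uniq//.
by move=> i; rewrite mem_filter => /andP[].
Qed.

(** * Word lengths in the wreath product *)

Section WreathWords.
Variables (H : groupType) (S : set H).
Hypothesis genS : generates S.
Local Notation T := (wreath_gens S).
Local Notation Gam := (wreath H).
Local Notation wr l z := ((l, z) : wreath H).

Let genT : generates T := wreath_gens_generates genS.

Lemma wreath_eq (g h : Gam) : g.1 =1 h.1 -> g.2 = h.2 -> g = h.
Proof. by case: g h => [l n] [m k] /= /lampsP -> ->. Qed.

Lemma wreath_mul1E (g h : Gam) x : (g * h)%g.1 x = (g.1 x * h.1 (x - g.2))%g.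
Proof. by rewrite wreath_mulE [LHS]lamps_mulE lamps_shiftE. Qed.

Lemma wreath_mul2E (g h : Gam) : (g * h)%g.2 = g.2 + h.2.
Proof. by []. Qed.

Lemma wreath_inv1E (g : Gam) x : (g^-1)%g.1 x = ((g.1 (x + g.2))^-1)%g.
Proof.
by rewrite wreath_invE [LHS]lamps_shiftE [LHS]lamps_invE opprK.
Qed.

Lemma wreath_of_baseM (a b : H) :
  wreath_of_base (a * b)%g = (wreath_of_base a * wreath_of_base b)%g.
Proof.
apply: wreath_eq => // x; rewrite wreath_mul1E subr0 !lamp_atE.
by case: ifP; rewrite ?mulg1.
Qed.

Lemma wreath_of_base1 : wreath_of_base 1%g = 1%g :> Gam.
Proof.
by apply: wreath_eq => // x; rewrite lamp_atE [RHS]lamps_oneE if_same.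
Qed.

Lemma wreath_of_baseV (a : H) :
  wreath_of_base a^-1%g = ((wreath_of_base a)^-1)%g.
Proof.
by apply: (mulIg (wreath_of_base a)); rewrite -wreath_of_baseM !mulVg wreath_of_base1.
Qed.

Lemma is_word_base n a : is_word S n a -> is_word T n (wreath_of_base a).
Proof.
move: n a; apply: is_word_ind; first by rewrite wreath_of_base1; apply: is_word1.
move=> a n x Sa Tx; rewrite wreath_of_baseM -add1n; apply: is_wordM => //.
case: Sa => Sa; first by apply: is_word_gen; left; exists a.
rewrite -(invgK a) wreath_of_baseV; apply: is_wordV.
by apply: is_word_gen; left; exists a^-1%g.
Qed.

(** A letter changes at most one lamp, by one letter of [H].  Reading the word
from its first letter, the configuration of the rest is translated by [s], so the
claim is proved for the lamps at all positions at once. *)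
Lemma is_word_lamp n (g : Gam) x : is_word T n g ->
  exists2 m, (m <= n)%N & is_word S m (g.1 x).
Proof.
move=> Tg; move: n g Tg x; apply: is_word_ind.
  by move=> x; exists 0%N => //; rewrite [X in is_word _ _ X]lamps_oneE; apply: is_word1.
move=> a n g Ta IH x.
have base b : is_word S 1 b ->
    exists2 m, (m <= n.+1)%N & is_word S m ((wreath_of_base b * g)%g.1 x).
  move=> Sb; have [m mn Sm] := IH x; rewrite wreath_mul1E subr0 lamp_atE.
  case: ifP => _; first by exists m.+1 => //; rewrite -add1n; apply: is_wordM.
  by exists m; [exact: leqW|rewrite mul1g].
case: Ta => -[[b Sb]|/=].
- by move=> <-; apply/base/is_word_gen.
- move=> ->; have [m mn Sm] := IH (x - 1); exists m; first exact: leqW.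
  by rewrite wreath_mul1E [X in (X * _)%g]lamps_oneE mul1g.
- move=> e; rewrite -(invgK a) -e -wreath_of_baseV.
  by apply/base/is_wordV/is_word_gen.
- move=> e; have [m mn Sm] := IH (x + 1); exists m; first exact: leqW.
  rewrite -(invgK a) e wreath_mul1E wreath_inv1E [X in (X^-1 * _)%g]lamps_oneE.
  by rewrite invg1 mul1g /= opprK.
Qed.

Lemma word_length_base a : word_length T (wreath_of_base a) = word_length S a.
Proof.
apply/eqP; rewrite eqn_leq; apply/andP; split.
  by apply: word_length_le => //; apply: is_word_base; apply: is_word_length.
have /(is_word_lamp 0)[m mn] := is_word_length (wreath_of_base a) genT.
by rewrite lamp_atE eqxx => Sm; apply: leq_trans mn; apply: word_length_le.
Qed.

Lemma word_dist_base (R : realType) a b :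
  word_dist R T (wreath_of_base a) (wreath_of_base b) = word_dist R S a b.
Proof. by rewrite /word_dist -wreath_of_baseV -wreath_of_baseM word_length_base. Qed.

Lemma is_word_translation (z : int) : is_word T `|z|%N (wr 1%g z).
Proof.
have pos n : is_word T n (wr 1%g n%:Z).
  elim: n => [|n IHn]; first exact: is_word1.
  have -> : wr 1%g n.+1%:Z = (wr 1%g n%:Z * wreath_s H)%g.
    apply: wreath_eq => [x|]; last by rewrite wreath_mul2E /=; lia.
    by rewrite wreath_mul1E /= ![lamps_fun _ _]lamps_oneE mulg1.
  by rewrite -addn1; apply: is_wordM => //; apply: is_word_gen; right.
case: (intP z) => [|n|n]; [exact: pos|exact: pos|].
have -> : wr 1%g (- n.+1%:Z) = ((wr 1%g n.+1%:Z)^-1)%g.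
  apply: wreath_eq => // x.
  by rewrite wreath_inv1E /= [X in (X^-1)%g]lamps_oneE invg1 [LHS]lamps_oneE.
by rewrite abszN; apply: is_wordV.
Qed.

(** Walk from 0 to [n], setting each lamp in passing. *)
Lemma is_word_sweep n (l : lamps H) :
  (forall x, l x <> 1%g -> 0 <= x < n%:Z) ->
  is_word T (\sum_(0 <= i < n) (word_length S (l i%:Z)).+1) (wr l n%:Z).
Proof.
elim: n l => [|n IHn] l ln.
  rewrite big_geq// (_ : wr l _ = 1%g); first exact: is_word1.
  apply: wreath_eq => // x; rewrite [RHS]lamps_oneE.
  by apply: contrapT => /ln; lia.
pose m : lamps H := (l * lamp_at n%:Z (l n%:Z)^-1)%g.
have mE x : m x = if x == n%:Z then 1%g else l x.
  rewrite [LHS]lamps_mulE lamp_atE; case: eqP => [->|_]; first exact: mulgV.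
  by rewrite mulg1.
have -> : wr l n.+1%:Z = (wr m n%:Z * (wreath_of_base (l n%:Z) * wreath_s H))%g.
  apply: wreath_eq; last by rewrite !wreath_mul2E /= add0r -addn1 PoszD.
  move=> x; rewrite !wreath_mul1E /= mE lamp_atE [X in (_ * (_ * X))%g]lamps_oneE.
  by rewrite mulg1 subr_eq0; case: eqP => [->|]; rewrite ?mul1g ?mulg1.
rewrite big_nat_recr//=; apply: is_wordM.
  rewrite (eq_big_nat _ _ (F2 := fun i => (word_length S (m i%:Z)).+1)); last first.
    by move=> i /andP[_ ni]; rewrite mE; case: eqP => // -[]; lia.
  by apply: IHn => x; rewrite mE; case: eqP => // xn /ln; lia.
rewrite -addn1; apply: is_wordM; last by apply: is_word_gen; right.
by apply: is_word_base; apply: is_word_length.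
Qed.

(** Walk to [-K], sweep to [K + 1] while setting the lamps, and walk back to
[g.2]: this takes at most [K + (2 K + 1) + (2 K + 1)] steps of the cursor. *)
Lemma wreath_length_le (K : nat) (g : Gam) :
  (forall x, g.1 x <> 1%g -> (`|x| <= K)%N) -> (`|g.2| <= K)%N ->
  (word_length T g <=
   5 * K + 2 + \sum_(0 <= i < K.*2.+1) word_length S (g.1 (i%:Z - K%:Z)%R))%N.
Proof.
move=> gK pK; pose l := lamps_shift K%:Z g.1.
have lE x : l x = g.1 (x - K%:Z) by rewrite /l lamps_shiftE.
have gE : g = (wr 1%g (- K%:Z) * (wr l K.*2.+1%:Z * wr 1%g (g.2 - K%:Z - 1)%R))%g.
  apply: wreath_eq; last by rewrite !wreath_mul2E /=; lia.
  move=> x; rewrite !wreath_mul1E /= ![(1%g : lamps H) _]lamps_oneE mul1g mulg1 lE.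
  by rewrite opprK addrK.
have lK x : l x <> 1%g -> 0 <= x < K.*2.+1%:Z by rewrite lE => /gK; lia.
have := is_wordM (is_word_translation (- K%:Z))
  (is_wordM (is_word_sweep lK) (is_word_translation (g.2 - K%:Z - 1))).
rewrite -gE => /(word_length_le genT) /leq_trans -> //.
rewrite (eq_bigr (fun i => (word_length S (g.1 (i%:Z - K%:Z)%R) + 1)%N)); last first.
  by move=> i _; rewrite lE addn1.
rewrite big_split /= sum_nat_const_nat; lia.
Qed.

End WreathWords.

(** * Half-spaces of the wreath product *)

Section Halfspaces.
Variable H : groupType.
Local Notation Gam := (wreath H).
Implicit Types (g h : Gam) (l m : lamps H) (k n x : int) (A : set Gam).

(** Consider the tree whose vertices are the pairs of a position [k] and of a
configuration of the lamps at the positions [x > k], the parent of a vertex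
being obtained by increasing [k] and forgetting a lamp.  An element [g] defines
the vertex at position [g.2], and [right_half k m] is the set of the elements
whose vertex descends from [(k, m)], that is, one side of the edge above
[(k, m)].  The sets [left_half k m] are those of the mirror image of the tree. *)
Definition right_half k m : set Gam :=
  [set g : Gam | g.2 <= k /\ forall x, k < x -> g.1 x = m x].
Definition left_half k m : set Gam :=
  [set g : Gam | k <= g.2 /\ forall x, x < k -> g.1 x = m x].
Definition halfspace A := exists k m, A = right_half k m \/ A = left_half k m.

(** The translate of [A] by [g^-1]. *)
Definition pullback g A : set Gam := [set h : Gam | A (g * h)%g].

Lemma pullback1 A : pullback 1%g A = A.
Proof. by apply/seteqP; split=> h; rewrite /pullback /= mul1g. Qed.

Lemma pullbackM g h A : pullback (g * h)%g A = pullback h (pullback g A).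
Proof. by apply/seteqP; split=> k; rewrite /pullback /= mulgA. Qed.

(** [Gamma] acts on both trees by automorphisms: the translate of the half-space
given by [k] and [m] is given by [k - g.2] and the configuration that [g] maps
to [m]. *)
Lemma halfspace_pullback g A : halfspace A -> halfspace (pullback g A).
Proof.
have lampE m x : lamps_shift (- g.2) (g.1^-1 * m)%g x
    = ((g.1 (x + g.2))^-1 * m (x + g.2)%R)%g.
  by rewrite lamps_shiftE opprK [LHS]lamps_mulE [X in (X * _)%g]lamps_invE.
move=> [k [m [] ->]]; exists (k - g.2), (lamps_shift (- g.2) (g.1^-1 * m)%g).
  left; apply/seteqP; split=> h [/= h2 h1]; split; rewrite ?wreath_mul2E in h2 *.
  - by rewrite lerBrDl.
  - move=> x kx; rewrite lampE -h1 ?wreath_mul1E ?addrK ?mulKg//.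
    by rewrite -ltrBlDr.
  - by rewrite -lerBrDl.
  - move=> x kx; rewrite wreath_mul1E h1 ?lampE ?subrK ?mulVKg//.
    by rewrite ltrD2r.
right; apply/seteqP; split=> h [/= h2 h1]; split; rewrite ?wreath_mul2E in h2 *.
- by rewrite lerBlDl.
- move=> x kx; rewrite lampE -h1 ?wreath_mul1E ?addrK ?mulKg//.
  by rewrite -ltrBrDr.
- by rewrite -lerBlDl.
- move=> x kx; rewrite wreath_mul1E h1 ?lampE ?subrK ?mulVKg//.
  by rewrite ltrD2r.
Qed.

Lemma halfspace_pullbackE g A : halfspace (pullback g A) <-> halfspace A.
Proof.
split; last exact: halfspace_pullback.
by move=> /(halfspace_pullback g^-1%g); rewrite -pullbackM mulgV pullback1.
Qed.

(** Changing the lamp at the cursor moves neither of the two vertices, since they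
involve the lamps strictly to the right and strictly to the left. *)
Lemma halfspace_base g a A :
  halfspace A -> (A (g * wreath_of_base a)%g <-> A g).
Proof.
have lE x : x != g.2 -> (g * wreath_of_base a)%g.1 x = g.1 x.
  by move=> xg; rewrite wreath_mul1E lamp_atE subr_eq0 (negPf xg) mulg1.
have g2 : (g * wreath_of_base a)%g.2 = g.2 by rewrite wreath_mul2E addr0.
move=> [k [m [] ->]]; split=> -[h2 h1]; split; rewrite ?g2 in h2 * => //.
- by move=> x kx; rewrite -h1// lE//; apply/eqP; lia.
- by move=> x kx; rewrite -h1// lE//; apply/eqP; lia.
- by move=> x kx; rewrite -h1// lE//; apply/eqP; lia.
- by move=> x kx; rewrite -h1// lE//; apply/eqP; lia.
Qed.

(** In each of the trees, a step of the cursor crosses a single edge: the one above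
[g] in the first tree, and the one above [g * s] in the second. *)
Lemma halfspace_s g A : halfspace A ->
  A = right_half g.2 g.1 \/ A = left_half (g.2 + 1) g.1 \/
  (A (g * wreath_s H)%g <-> A g).
Proof.
have lE x : (g * wreath_s H)%g.1 x = g.1 x.
  by rewrite wreath_mul1E [X in (_ * X)%g]lamps_oneE mulg1.
have g2 : (g * wreath_s H)%g.2 = g.2 + 1 by [].
move=> [k [m [] ->]].
- have [kg|kg] := eqVneq k g.2; last first.
    right; right; split=> -[h2 h1]; split; rewrite ?g2 in h2 *; try lia.
      by move=> x /h1; rewrite lE.
    by move=> x /h1; rewrite lE.
  have [gm|gm] := pselect (forall x, k < x -> g.1 x = m x).
    left; rewrite kg in gm *; apply/seteqP.
    by split=> h [h2 h1]; split=> // x kx; rewrite h1// gm.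
  by right; right; split=> -[h2 h1]; case: gm => x /h1; rewrite ?lE.
- have [kg|kg] := eqVneq k (g.2 + 1); last first.
    right; right; split=> -[h2 h1]; split; rewrite ?g2 in h2 *; try lia.
      by move=> x /h1; rewrite lE.
    by move=> x /h1; rewrite lE.
  have [gm|gm] := pselect (forall x, x < k -> g.1 x = m x).
    right; left; rewrite kg in gm *; apply/seteqP.
    by split=> h [h2 h1]; split=> // x kx; rewrite h1// gm.
  by right; right; split=> -[h2 h1]; case: gm => x /h1; rewrite ?lE.
Qed.

Lemma right_half_inj m : injective (right_half^~ m).
Proof.
move=> j k jk; have mem i : right_half i m (m, i) by split=> /=.
have := mem j; rewrite [in right_half j m]jk => -[/= jk1 _].
by have := mem k; rewrite -[in right_half k m]jk => -[/= kj _]; lia.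
Qed.

Lemma left_half_inj m : injective (left_half^~ m).
Proof.
move=> j k jk; have mem i : left_half i m (m, i) by split=> /=.
have := mem j; rewrite [in left_half j m]jk => -[/= jk1 _].
by have := mem k; rewrite -[in left_half k m]jk => -[/= kj _]; lia.
Qed.

(** All the activity of [g] takes place in the interval [[-K, K]]. *)
Definition extent_le (K : nat) g :=
  (forall x, g.1 x <> 1%g -> (`|x| <= K)%N) /\ (`|g.2| <= K)%N.

Lemma extent_exists g : exists K, extent_le K g.
Proof.
exists (`|g.2| + \sum_(x <- finsupp g.1) `|x|)%N; split; last exact: leq_addr.
move=> x gx; have xs : x \in finsupp g.1.
  by apply/negPn/negP => /lamps_out.
by rewrite (big_rem x)//= addnCA leq_addr.
Qed.

(** Take [K] minimal for [d = g^-1 h].  If [K > 0], then [d] moves the cursor to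
[K] or [-K], or has a lamp on there.  In the tree of the corresponding side,
every edge on the way up from [g] to the distance [K] has to be crossed to reach
[h]. *)
Lemma extent_separated g h : exists K : nat, extent_le K (g^-1 * h)%g /\
  exists As : seq (set Gam), [/\ uniq As, size As = K &
    forall A, A \in As -> [/\ halfspace A, A g & ~ A h]].
Proof.
set d := (g^-1 * h)%g.
have exK : exists K, `[<extent_le K d>].
  by have [K Kd] := extent_exists d; exists K; apply/asboolP.
case: (ex_minnP exK) => K /asboolP Kd Kmin; exists K; split=> //.
have hE : h = (g * d)%g by rewrite mulVKg.
have h1 x : h.1 x = (g.1 x * d.1 (x - g.2))%g by rewrite hE wreath_mul1E.
have h2 : h.2 = g.2 + d.2 by rewrite hE.
clearbody d.
case: K Kd Kmin => [|K] [dK1 dK2] Kmin; first by exists [::].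
have {Kmin} : [\/ d.2 = K.+1, d.1 K.+1 <> 1%g, d.2 = - K.+1%:Z | d.1 (- K.+1%:Z) <> 1%g].
  apply: contrapT => n4; have : extent_le K d.
    have d2 : (`|d.2| <= K)%N.
      rewrite leqNgt; apply/negP => d2; apply: n4.
      case: (lerP 0 d.2) => d0; [apply: Or41|apply: Or43]; lia.
    split=> // x dx; rewrite leqNgt; apply/negP => xK; apply: n4.
    have xK' := dK1 x dx.
    case: (lerP 0 x) => x0.
      by apply: Or42; rewrite (_ : K.+1%:Z = x)//; lia.
    by apply: Or44; rewrite (_ : - K.+1%:Z = x)//; lia.
  by move/asboolP/Kmin; rewrite ltnn.
have right_case : d.2 = K.+1 \/ d.1 K.+1 <> 1%g ->
    exists As : seq (set Gam), [/\ uniq As, size As = K.+1 &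
      forall A, A \in As -> [/\ halfspace A, A g & ~ A h]].
  move=> dK; exists [seq right_half (g.2 + i%:Z) g.1 | i <- iota 0 K.+1]; split.
  - rewrite map_inj_uniq ?iota_uniq// => i j /right_half_inj/addrI ij.
    by case: ij.
  - by rewrite size_map size_iota.
  move=> A /mapP[i]; rewrite mem_iota => iK ->; split.
  - by exists (g.2 + i%:Z), g.1; left.
  - by split=> //; lia.
  move=> [hk hx]; case: dK => dK; first by rewrite h2 dK in hk; lia.
  apply: dK; have := hx (g.2 + K.+1%:Z); rewrite h1 (addrC g.2 K.+1%:Z) addrK => /(_ _)hK.
  by apply: (mulgI (g.1 (K.+1%:Z + g.2))); rewrite mulg1 hK//; lia.
have left_case : d.2 = - K.+1%:Z \/ d.1 (- K.+1%:Z) <> 1%g ->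
    exists As : seq (set Gam), [/\ uniq As, size As = K.+1 &
      forall A, A \in As -> [/\ halfspace A, A g & ~ A h]].
  move=> dK; exists [seq left_half (g.2 - i%:Z) g.1 | i <- iota 0 K.+1]; split.
  - rewrite map_inj_uniq ?iota_uniq// => i j /left_half_inj/addrI/oppr_inj ij.
    by case: ij.
  - by rewrite size_map size_iota.
  move=> A /mapP[i]; rewrite mem_iota => iK ->; split.
  - by exists (g.2 - i%:Z), g.1; right.
  - by split=> //; lia.
  move=> [hk hx]; case: dK => dK; first by rewrite h2 dK in hk; lia.
  apply: dK; have := hx (g.2 - K.+1%:Z); rewrite h1 (addrC g.2 (- K.+1%:Z)) addrK => /(_ _)hK.
  by apply: (mulgI (g.1 (- K.+1%:Z + g.2))); rewrite mulg1 hK//; lia.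
by case; [move=> ?; apply: right_case; left|move=> ?; apply: right_case; right|
  move=> ?; apply: left_case; left|move=> ?; apply: left_case; right].
Qed.

End Halfspaces.

(** * Estimates for real powers and suprema *)

Section RealEstimates.
Variable R : realType.
Implicit Types (x y q : R).

(** Concavity in its simplest form: [t <= t ^ q] for [t = x / (x + y)] and
[t = y / (x + y)]. *)
Lemma powR_subadditive x y q : 0 < q <= 1 -> 0 <= x -> 0 <= y ->
  (x + y) `^ q <= x `^ q + y `^ q.
Proof.
move=> /andP[q0 q1] x0 y0.
have [xy0|xyN0] := eqVneq (x + y) 0.
  by rewrite xy0 powR0 ?gt_eqF// addr_ge0 ?powR_ge0.
have s0 : 0 < x + y by rewrite lt0r xyN0 addr_ge0.
have part z : 0 <= z <= x + y -> z / (x + y) * (x + y) `^ q <= z `^ q.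
  move=> /andP[z0 zs].
  have [->|zN0] := eqVneq z 0; first by rewrite !mul0r powR_ge0.
  have zgt0 : 0 < z by rewrite lt0r zN0.
  rewrite -{2}(divfK xyN0 z) [leRHS]powRM ?divr_ge0 ?(ltW s0)//.
  rewrite ler_wpM2r ?powR_ge0// ger1_powR// divr_gt0//=.
  by rewrite ler_pdivrMr// mul1r.
have px := part x; have py := part y.
apply: le_trans (lerD (px _) (py _)); [|lra|lra].
by rewrite -mulrDl -mulrDl divff// mul1r.
Qed.

Lemma powR_sum_le (I : Type) (r : seq I) (f : I -> R) q :
  0 < q <= 1 -> (forall i, 0 <= f i) ->
  (\sum_(i <- r) f i) `^ q <= \sum_(i <- r) f i `^ q.
Proof.
move=> q01 f0; elim: r => [|i r IHr].
  by rewrite !big_nil powR0// gt_eqF//; case/andP: q01.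
rewrite !big_cons; apply: le_trans (powR_subadditive q01 _ _) _ => //.
  by apply: sumr_ge0.
by rewrite lerD2l.
Qed.

(** By subadditivity the left-hand side is at most [(5 K + 2) ^ q] plus the sum of
the powers, and [(5 K + 2) ^ q <= 5 K + 2]; the hypothesis that [K] plus the sum
is at least 1 absorbs the constant 2, hence the factor 7. *)
Lemma powR_word_bound (D K n : nat) (a : nat -> nat) q :
  0 < q <= 1 -> (D <= 5 * K + 2 + \sum_(0 <= i < n) a i)%N ->
  1 <= K%:R + \sum_(0 <= i < n) (a i)%:R `^ q ->
  D%:R `^ q <= 7 * (K%:R + \sum_(0 <= i < n) (a i)%:R `^ q).
Proof.
move=> q01 DK one; have /andP[q0 q1] := q01.
set s := \sum_(0 <= i < n) _ in one *.
have K0 : 0 <= K%:R :> R by [].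
apply: (@le_trans _ _ ((5 * K%:R + 2 + \sum_(0 <= i < n) (a i)%:R) `^ q)).
  apply: ge0_ler_powR; rewrite ?nnegrE ?(ltW q0)//.
    by rewrite addr_ge0 ?sumr_ge0// addr_ge0// mulr_ge0.
  by rewrite -natr_sum -natrM -!natrD ler_nat.
apply: le_trans (powR_subadditive q01 _ _) _; [lra|exact: sumr_ge0|].
have := powR_sum_le (index_iota 0 n) q01 (fun i => ler0n R (a i)).
rewrite -/s => sums.
have s0 : 0 <= s by rewrite sumr_ge0// => i _; apply: powR_ge0.
have : (5 * K%:R + 2) `^ q <= 5 * K%:R + 2 by apply: ler1_powR => //; lra.
lra.
Qed.


Lemma sup_unit (A : set R) : (forall x, A x -> 0 <= x <= 1) -> 0 <= sup A <= 1.
Proof.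
move=> A01; have [->|/set0P[x Ax]] := eqVneq A set0; first by rewrite sup0 lexx ler01.
have Aub : ubound A 1 by move=> y /A01/andP[].
apply/andP; split; last by apply: ge_sup => //; exists x.
have /andP[x0 _] := A01 x Ax; apply: le_trans x0 _.
by apply: sup_upper_bound => //; split; [exists x|exists 1].
Qed.

Lemma sup_le_subset (A B : set R) :
  A `<=` B -> (forall x, B x -> 0 <= x <= 1) -> sup A <= sup B.
Proof.
move=> AB B01; have [->|/set0P[x Ax]] := eqVneq A set0.
  by rewrite sup0; have /andP[] := sup_unit B01.
apply: ge_sup; first by exists x.
move=> y /AB By; apply: sup_upper_bound => //; split; first by exists y.
by exists 1 => z /B01/andP[].
Qed.

(** The elements [x > 0] are enough: if the supremum of [A] is 0 there is nothing
to prove. *)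
Lemma sup_min_le (A B : set R) (c : R) : 0 <= c ->
  (forall x, A x -> 0 <= x <= 1) -> (forall x, B x -> 0 <= x <= 1) ->
  (forall x, A x -> 0 < x -> B (Num.min x c)) ->
  Num.min (sup A) c <= sup B.
Proof.
move=> c0 A01 B01 AB; rewrite leNgt lt_min; apply/negP => /andP[BA Bc].
have /andP[B0 _] := sup_unit B01.
have [A0|/set0P An0] := eqVneq A set0; first by move: BA; rewrite A0 sup0; lra.
have [x Ax Bx] := sup_gt An0 BA.
have Bm := AB x Ax (le_lt_trans B0 Bx).
suff : Num.min x c <= sup B by rewrite leNgt lt_min Bx Bc.
apply: sup_upper_bound => //; split; first by exists (Num.min x c).
by exists 1 => z /B01/andP[].
Qed.

End RealEstimates.

(** Distinct points are at distance at least 1, so the lower bound weakens when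
the exponent decreases. *)
Lemma compression_bounds_le (R : realType) (G : groupType) (T : set G)
    (V : normedModType R) (f : G -> V) (a b : R) : generates T -> b <= a ->
  compression_bounds (word_dist R T) f a -> compression_bounds (word_dist R T) f b.
Proof.
move=> genT ba [C1 [C2 [C10 C20 fC]]]; exists C1, C2; split=> // x y xy.
have /andP[lo ->] := fC x y xy; rewrite andbT; apply: le_trans lo.
by rewrite ler_wpM2l ?(ltW C10)// ler_powR// word_dist_ge1.
Qed.

(** * The embedding of the wreath product *)

Section WreathEmbedding.
Variables (R : realType) (H : groupType) (S : set H).
Hypothesis genS : generates S.
Variables (V : completeNormedModType R) (F : H -> V).
Local Notation Gam := (wreath H).
Local Notation T := (wreath_gens S).
Local Notation I := (int + set Gam)%type.

Definition summand (i : I) : completeNormedModType R :=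
  match i with inl _ => V | inr _ => R^o end.

Lemma summand_hilbert : is_hilbert V -> forall i, is_hilbert (summand i).
Proof. by move=> hV [x|A] //=; apply: realType_hilbert. Qed.

(** Indexing the truth values by all subsets, those that are not half-spaces
contributing 0, lets [Gamma] act by [pullback] on the whole index set. *)
Definition profile (g : Gam) (i : I) : summand i :=
  match i with
  | inl x => F (g.1 x)
  | inr A => (`[< halfspace A /\ A g >])%:R
  end.

Arguments profile : simpl never.

Lemma profile_inl g x : profile g (inl x) = F (g.1 x).
Proof. by []. Qed.

Lemma profile_inr g A : profile g (inr A) = (`[< halfspace A /\ A g >])%:R.
Proof. by []. Qed.

(** A base generator only changes the lamp at the cursor, which moves the value of
[F] by at most [C]; the generator [s] only changes the truth values of two
half-spaces.  Both [C ^ 2] and 2 are at most [(C + 2) ^ 2]. *)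
Lemma profile_gen (C : R) g t : 0 <= C ->
  (forall a b, S b -> `|F (a * b)%g - F a| <= C) -> T t ->
  (sqn (fun i => profile (g * t)%g i - profile g i)%R <= ((C + 2) ^+ 2)%:E)%E.
Proof.
move=> C0 FC [[b Sb <-]|->].
- have inr0 A : profile (g * wreath_of_base b)%g (inr A) - profile g (inr A) = 0.
    rewrite !profile_inr (_ : `[< _ >] = `[< halfspace A /\ A g >]) ?subrr//.
    by apply: asbool_equiv_eq; split=> -[hA];
      [move/(halfspace_base _ _ hA)|move=> ?; split=> //; apply/halfspace_base].
  apply: (@le_trans _ _ (C ^+ 2 * (size [:: inl g.2 : I])%:R)%:E); last first.
    by rewrite lee_fin /=; nra.
  apply: sqn_le_support; first exact: sqr_ge0.
    move=> [x|A]; last by move=> _; exact: inr0.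
    rewrite inE /= !profile_inl => xg.
    rewrite wreath_mul1E lamp_atE subr_eq0 ifF ?mulg1 ?subrr//.
    by apply/eqP => xg'; rewrite xg' eqxx in xg.
  move=> [x|A] /=; last by rewrite inr0 normr0 expr0n sqr_ge0.
  rewrite !profile_inl wreath_mul1E lamp_atE; case: ifP => _.
    by rewrite ler_pXn2r// ?nnegrE//; apply: FC.
  by rewrite mulg1 subrr normr0 expr0n sqr_ge0.
- have inl0 x : profile (g * wreath_s H)%g (inl x) - profile g (inl x) = 0.
    by rewrite !profile_inl wreath_mul1E [X in (_ * X)%g]lamps_oneE mulg1 subrr.
  pose r : seq I := [:: inr (right_half g.2 g.1); inr (left_half (g.2 + 1) g.1)].
  apply: (@le_trans _ _ (1 * (size r)%:R)%:E); last first.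
    by rewrite lee_fin /=; nra.
  apply: sqn_le_support => //.
    move=> [x|A]; first by move=> _; exact: inl0.
    rewrite !inE negb_or => /andP[/eqP nr /eqP nl].
    rewrite /= !profile_inr (_ : `[< _ >] = `[< halfspace A /\ A g >]) ?subrr//.
    have sA : halfspace A -> A (g * wreath_s H)%g <-> A g.
      move=> hA; have [e|[e|//]] := halfspace_s g hA; first by case: nr; rewrite e.
      by case: nl; rewrite e.
    by apply: asbool_equiv_eq; split=> -[hA] /(sA hA).
  move=> [x|A] /=; first by rewrite inl0 normr0 expr0n.
  rewrite !profile_inr; case: `[< _ >]; case: `[< _ >];
    by rewrite ?subrr ?subr0 ?sub0r ?normrN ?normr0 ?normr1 ?expr1n ?expr0n.
Qed.

(** The squared distance is at least the contribution of the [K] half-spaces that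
separate [g] from [h], and of the lamps in the window of radius [K] around the
cursor of [g], where all the differences between [g] and [h] lie. *)
Lemma profile_lower (C a : R) g h : 0 < C -> 0 < a <= 1 / 2 -> g <> h ->
  (forall x y, x <> y -> C * word_dist R S x y `^ a <= `|F x - F y|) ->
  ((Num.min 1 (C ^+ 2) / 7 * (word_dist R T g h `^ a) ^+ 2)%:E <=
   sqn (fun i => profile g i - profile h i)%R)%E.
Proof.
move=> C0 /andP[a0 a12] gh FC.
have [K [dK [As [uAs sAs AsP]]]] := extent_separated g h.
pose d := (g^-1 * h)%g.
have dE x : d.1 (x - g.2) = ((g.1 x)^-1 * h.1 x)%g.
  rewrite wreath_mul1E wreath_inv1E subrK; congr (_ * h.1 _)%g.
  by rewrite /= opprK subrK.
pose n := K.*2.+1; pose l i := word_length S (d.1 (i%:Z - K%:Z)).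
pose p i : int := i%:Z - K%:Z + g.2.
have lE i : l i = word_length S ((g.1 (p i))^-1 * h.1 (p i))%g.
  by rewrite /l -dE /p addrK.
have q01 : 0 < a * 2 <= 1 by lra.
pose s : R := \sum_(0 <= i < n) (l i)%:R `^ (a * 2).
have s_ge0 : 0 <= s by apply: sumr_ge0 => i _; apply: powR_ge0.
(* If [K = 0], the elements differ only by the lamp at the cursor. *)
have one : 1 <= K%:R + s.
  case: (posnP K) => [K0|K0]; last by rewrite -[leLHS]addr0 lerD// ler1n.
  rewrite K0 add0r /s /n K0 /= big_nat1.
  have l0 : (0 < l 0)%N.
    rewrite lt0n; apply/eqP => /(word_length0 genS); rewrite K0 subrr => d0.
    apply: gh; apply/eqP; rewrite eq_sym -(inj_eq (mulgI g^-1%g)) mulVg; apply/eqP.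
    case: dK; rewrite -/d K0 => d1 d2; apply: wreath_eq => [x|]; last first.
      by apply/eqP; rewrite -[X in _ == X]/0 -absz_eq0 -leqn0.
    rewrite [RHS]lamps_oneE; apply: contrapT => dx; have x0 : x = 0 by have := d1 x dx; lia.
    by apply: dx; rewrite x0.
  have e1 : 1 `^ (a * 2) = 1 :> R by rewrite powR1.
  rewrite -[leLHS]e1; apply: ge0_ler_powR; rewrite ?nnegrE ?ler1n//; lra.
have word := powR_word_bound q01 (wreath_length_le genS dK.1 dK.2) one.
pose xs : seq I := [seq inl (p i) | i <- iota 0 n] ++ [seq inr A | A <- As].
have uxs : uniq xs.
  rewrite cat_uniq map_inj_uniq ?iota_uniq/=; last first.
    by move=> i j [] /addIr/addIr[].
  rewrite map_inj_uniq ?uAs ?andbT; last by move=> A B [].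
  by apply/hasPn => i /mapP[A _ ->]; apply/negP => /mapP[].
apply: le_trans (sqn_ge _ uxs); rewrite lee_fin big_cat.
rewrite [X in _ <= X + _]big_map [X in _ <= _ + X]big_map.
have sumAs : \sum_(A <- As) `|profile g (inr A) - profile h (inr A)| ^+ 2 = K%:R :> R.
  rewrite big_seq (eq_bigr (fun=> 1)); last first.
    move=> A /AsP[hA gA hNA]; rewrite !profile_inr asboolT// asboolF ?subr0 ?normr1 ?expr1n//.
    by case.
  by rewrite -big_seq big_const_seq iter_addr_0 count_predT sAs.
rewrite sumAs.
set k := Num.min 1 (C ^+ 2).
have k0 : 0 <= k by rewrite le_min ler01 sqr_ge0.
have k1 : k <= 1 by rewrite ge_min lexx.
have kC : k <= C ^+ 2 by rewrite ge_min lexx orbT.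
have coord i : k * (l i)%:R `^ (a * 2) <=
    `|profile g (inl (p i)) - profile h (inl (p i))| ^+ 2.
  rewrite !profile_inl; have [e|e] := pselect (g.1 (p i) = h.1 (p i)).
    have -> : l i = 0%N.
      apply/eqP; rewrite lE e mulVg -leqn0; apply: word_length_le => //.
      exact: is_word1.
    by rewrite powR0 ?mulr0 ?sqr_ge0// gt_eqF//; case/andP: q01.
  apply: (@le_trans _ _ ((C * (l i)%:R `^ a) ^+ 2)).
    by rewrite exprMn powRrM powR_mulrn ?powR_ge0// ler_wpM2r ?sqr_ge0.
  rewrite ler_pXn2r ?nnegrE ?mulr_ge0 ?powR_ge0 ?(ltW C0)//.
  by rewrite lE; apply: FC.
have sum_coord : k * s <= \sum_(i <- iota 0 n)
    `|profile g (inl (p i)) - profile h (inl (p i))| ^+ 2.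
  by rewrite mulr_sumr /index_iota subn0; apply: ler_sum.
apply: le_trans (lerD sum_coord (lexx _)).
move: word; rewrite -/d -/n -/s powRrM powR_mulrn ?powR_ge0//.
rewrite /word_dist -/d; set D := (_%:R `^ a) ^+ 2 => word.
have K0 : 0 <= K%:R :> R by [].
have : k * D <= k * (7 * (K%:R + s)) by rewrite ler_wpM2l.
nra.
Qed.

End WreathEmbedding.

Section WreathCompression.
Variables (R : realType) (H : groupType) (S : set H).
Hypothesis genS : generates S.
Variables (V : completeNormedModType R) (F : H -> V).
Hypothesis hV : is_hilbert V.
Local Notation Gam := (wreath H).
Local Notation T := (wreath_gens S).
Local Notation I := (int + set Gam)%type.

Let genT : generates T := wreath_gens_generates genS.

Lemma profile_compression (a : R) : 0 < a <= 1 / 2 ->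
  compression_bounds (word_dist R S) F a ->
  exists fin : forall g h, (sqn (fun i => profile F g i - profile F h i)%R < +oo)%E,
    compression_bounds (word_dist R T) (hsum_map (summand_hilbert hV) fin) a.
Proof.
move=> a01 [C1 [C2 [C10 C20 FC]]].
have F_gen x b : S b -> `|F (x * b)%g - F x| <= C2.
  move=> Sb; have [->|xb] := pselect ((x * b)%g = x).
    by rewrite subrr normr0 ltW.
  have /andP[_ up] := FC _ _ xb; apply: le_trans up _.
  rewrite -[leRHS]mulr1 ler_wpM2l ?(ltW C20)// word_distC// /word_dist mulKg.
  by rewrite lern1; apply: word_length_le => //; apply: is_word_gen.
have c0 : 0 <= C2 + 2 by rewrite addr_ge0// ltW.
have gen g t := @profile_gen R H S V F C2 g t (ltW C20) F_gen.
exists (sqn_orbit_fin genT gen).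
pose k : R := Num.min 1 (C1 ^+ 2) / 7.
have k0 : 0 < k by rewrite divr_gt0// lt_min ltr01 exprn_gt0.
exists (Num.sqrt k), (C2 + 2); split; first by rewrite sqrtr_gt0.
  by rewrite addr_gt0.
move=> g h gh; apply/andP; split; last exact: hsum_map_lipschitz.
rewrite -(@ler_pXn2r _ 2)// ?nnegrE ?mulr_ge0 ?sqrtr_ge0 ?powR_ge0//.
rewrite exprMn sqr_sqrtr ?(ltW k0)// -lee_fin hsum_map_dist.
by apply: profile_lower => // x y /FC/andP[].
Qed.

Variable rho : H -> V -> V.
Hypothesis rho_action : is_action rho.
Hypothesis rho_iso : forall a, is_affine_isometry (rho a).
Hypothesis rhoF : forall a b, F (a * b)%g = rho a (F b).

(** The extension of the action to all families: [H] acts on each copy of [V]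
through the value of the lamp, and the indices are permuted as in [Gamma]. *)
Definition profile_act (g : Gam) (u : forall i, summand V i) (i : I) : summand V i :=
  match i with
  | inl x => rho (g.1 x) (u (inl (x - g.2)))
  | inr A => u (inr (pullback g A))
  end.

Lemma profile_act_iso g (u v : forall i, summand V i) :
  sqn (fun i => profile_act g u i - profile_act g v i)%R
  = sqn (fun i => u i - v i)%R.
Proof.
pose e (i : I) : I :=
  match i with inl x => inl (x - g.2) | inr A => inr (pullback g A) end.
pose e' (i : I) : I :=
  match i with inl x => inl (x + g.2) | inr A => inr (pullback g^-1%g A) end.
have e_bij : bijective e.
  by exists e' => -[x|A] /=; rewrite ?subrK ?addrK -?pullbackM ?mulgV ?mulVg ?pullback1.
rewrite /sqn [RHS](reindex_esum setT setT e) //; last by rewrite setTT_bijective.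
apply: eq_esum => -[x|A] _ //; congr ((_ ^+ 2)%:E).
exact: (rho_iso _).2.
Qed.

Lemma profile_equivariant
    (fin : forall g h, (sqn (fun i => profile F g i - profile F h i)%R < +oo)%E) :
  exists rho' : Gam -> hsum (summand_hilbert hV) -> hsum (summand_hilbert hV),
    [/\ is_action rho', forall g, is_affine_isometry (rho' g) &
        forall g h, hsum_map (summand_hilbert hV) fin (g * h)%g
          = rho' g (hsum_map (summand_hilbert hV) fin h)].
Proof.
apply: (@hsum_map_affine R I (summand V) (summand_hilbert hV) Gam (profile F) fin profile_act).
- move=> u; apply: functional_extensionality_dep => -[x|A] /=.
    by rewrite subr0 [X in rho X]lamps_oneE rho_action.1.
  by rewrite pullback1.
- move=> g h u; apply: functional_extensionality_dep => -[x|A].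
    rewrite [LHS]/= wreath_mul1E rho_action.2.
    by rewrite opprD addrA.
  by rewrite /= pullbackM.
- exact: profile_act_iso.
- move=> g h; apply: functional_extensionality_dep => -[x|A].
    by rewrite profile_inl wreath_mul1E rhoF.
  rewrite !profile_inr; congr (_%:R); congr nat_of_bool.
  apply: asbool_equiv_eq; split=> -[hA gA]; split=> //.
    exact: halfspace_pullback.
  by move/halfspace_pullbackE: hA.
Qed.

End WreathCompression.

(** * Compression of the wreath product *)

Theorem theorem0p2 (R : realType) (H : groupType) (S : set H)
  (hS : generates S) :
  let RH := group_compression R S in
  let RHeq := group_equivariant_compression R S in
  let RGamma := group_compression R (wreath_gens S) in
  let RGammaeq := group_equivariant_compression R (wreath_gens S) in
  (RGamma <= RH /\ RH / (RH + 1) <= RGamma) /\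
  (RGammaeq <= RHeq /\
   Num.max (RHeq - 1 / 2) (RHeq / (2 * RHeq + 1)) <= RGammaeq).
Proof.
move=> RH RHeq RGamma RGammaeq.
have half0 : 0 <= 1 / 2 :> R by lra.
have min01 (x : R) : 0 <= x <= 1 -> 0 < x ->
    0 < Num.min x (1 / 2) <= 1 / 2 /\ 0 <= Num.min x (1 / 2) <= 1.
  move=> x01 x0; have m0 : 0 < Num.min x (1 / 2) by rewrite lt_min x0; lra.
  have m1 : Num.min x (1 / 2) <= 1 / 2 by rewrite ge_min lexx orbT.
  by split; apply/andP; split => //; lra.
have restrict (V : completeNormedModType R) (f : wreath H -> V) a :
    compression_bounds (word_dist R (wreath_gens S)) f a ->
    compression_bounds (word_dist R S) (f \o @wreath_of_base H) a.
  move=> [C1 [C2 [C10 C20 fC]]]; exists C1, C2; split=> // x y xy.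
  rewrite -(word_dist_base hS); apply: fC => e; apply: xy.
  have /(congr1 (fun g : wreath H => g.1 0)) := e.
  by rewrite /= !lamp_atE eqxx.
(* The exponent is first decreased to at most 1/2, where the embedding of the
   wreath product loses nothing. *)
have lower : Num.min RH (1 / 2) <= RGamma.
  apply: sup_min_le => //; [by move=> x [] | by move=> x []|].
  move=> x [x01 [V hV [F Fx]]] x0; have [m0 m1] := min01 x x01 x0; split=> //.
  have {}Fx : compression_bounds (word_dist R S) F (Num.min x (1 / 2)).
    by apply: compression_bounds_le Fx => //; rewrite ge_min lexx.
  have [fin bnd] := profile_compression hS hV m0 Fx.
  exists (hsum (summand_hilbert (H := H) hV)); first exact: hsum_hilbert.
  by exists (hsum_map (summand_hilbert hV) fin).
have lower_eq : Num.min RHeq (1 / 2) <= RGammaeq.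
  apply: sup_min_le => //; [by move=> x [] | by move=> x []|].
  move=> x [x01 [V hV [rho [ract riso [F Feq Fx]]]]] x0.
  have [m0 m1] := min01 x x01 x0; split=> //.
  have {}Fx : compression_bounds (word_dist R S) F (Num.min x (1 / 2)).
    by apply: compression_bounds_le Fx => //; rewrite ge_min lexx.
  have [fin bnd] := profile_compression hS hV m0 Fx.
  have [rho' [act' iso' eq']] := profile_equivariant hV ract riso Feq fin.
  exists (hsum (summand_hilbert (H := H) hV)); first exact: hsum_hilbert.
  by exists rho'; split=> //; exists (hsum_map (summand_hilbert hV) fin).
have RH01 : 0 <= RH <= 1 by apply: sup_unit => x [].
have RHeq01 : 0 <= RHeq <= 1 by apply: sup_unit => x [].
split; split.
- apply: sup_le_subset => [x [x01 [V hV [f fx]]]|x []//]; split=> //.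
  by exists V => //; exists (f \o @wreath_of_base H); apply: restrict.
- apply: le_trans lower; rewrite le_min; have /andP[r0 r1] := RH01.
  rewrite !ler_pdivrMr; try lra; apply/andP; split; nra.
- apply: sup_le_subset => [x [x01 [V hV [rho [ract riso [f feq fx]]]]]|x []//].
  split=> //; exists V => //; exists (fun a => rho (wreath_of_base a)); split=> //.
    split=> [v|a b v]; first by rewrite wreath_of_base1 ract.1.
    by rewrite wreath_of_baseM ract.2.
  exists (f \o @wreath_of_base H); last exact: restrict.
  by move=> a b; rewrite /= wreath_of_baseM feq.
- apply: le_trans lower_eq; rewrite le_min !ge_max; have /andP[r0 r1] := RHeq01.
  rewrite !ler_pdivrMr; try lra.
  by apply/andP; split; apply/andP; split; nra.
Qed.
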